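(* Let $s\ge 1$, $G=(\mathbb{Z}/2\mathbb{Z})^s$, and let $(G,\mathcal T,\mathcal Z)$ be a tame decomposition configuration, $\mathcal T=\{T_1,\dots,T_s\}$, $T_i=\langle x_i\rangle$, $\mathcal Z=\{Z_1,\dots,Z_s\}$. Then $(G,\mathcal T,\mathcal Z)$ is realizable over $\mathbb{Q}$ if and only if the associated sign matrix $S_{\mathcal Z}$ is a QR matrix. For $s\le 2$ every tame decomposition configuration for $(\mathbb{Z}/2\mathbb{Z})^s$ is realizable over $\mathbb{Q}$, while for every $s\ge 3$ there exist tame decomposition configurations for $(\mathbb{Z}/2\mathbb{Z})^s$ that are not realizable over $\mathbb{Q}$.
   Context: A (minimal) tame decomposition configuration for $G=(\mathbb{Z}/2\mathbb{Z})^s$ consists of cyclic subgroups $T_1,\dots,T_s$ generating $G$ (necessarily $T_i=\langle x_i\rangle$ of order 2 and $G=T_1\times\cdots\times T_s$) and subgroups $Z_1,\dots,Z_s$ with $T_i\le Z_i$ and $Z_i/T_i$ cyclic. For each $i$ let $z_i$ be the generator of the group $Z_i\cap\prod_{j\ne i}T_j$ (of order $\le 2$), and write $z_i=\prod_j x_j^{a_{ij}}$ with $a_{ij}\in\{0,1\}$, $a_{ii}=0$. The sign matrix $S_{\mathcal Z}=(m_{ij})$ is the $s\times s$ matrix with $m_{ii}=0$ and $m_{ij}=(-1)^{a_{ij}}$ for $i\ne j$. A sign matrix (zero diagonal, off-diagonal entries $\pm1$) $M=(m_{ij})$ is a QR matrix if there are distinct odd primes $p_1,\dots,p_s$ with $m_{ij}=\left(\frac{p_i}{p_j}\right)$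 (Legendre symbol) for all $i\ne j$. Realizable over $\mathbb{Q}$: there exist a tamely ramified Galois extension $K/\mathbb{Q}$ and an isomorphism $\varphi:\operatorname{Gal}(K/\mathbb{Q})\to G$ such that, with $p_1,\dots,p_s$ all the finite primes ramified in $K$ (suitably ordered), for each $i$ some prime $\wp_i$ of $K$ over $p_i$ has $\varphi(T(\wp_i/(p_i)))=T_i$ and $\varphi(Z(\wp_i/(p_i)))=Z_i$ (inertia and decomposition groups). *)

(* Defs.v *)
From HB Require Import structures.
From mathcomp Require Import all_boot all_order all_algebra all_fingroup all_solvable all_field.
Set Implicit Arguments. Unset Strict Implicit. Unset Printing Implicit Defensive.
Import GRing.Theory.

Local Open Scope group_scope.

Definition tame_config (s : nat) (gT : finGroupType) (G : {group gT})
    (T Z : 'I_s -> {group gT}) : Prop :=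
  [/\ 2.-abelem G, #|G| = (2 ^ s)%N,
      <<\bigcup_(i < s) T i>> = G :> {set gT} &
      forall i, [/\ cyclic (T i), T i \subset Z i, Z i \subset G
                  & cyclic (Z i / T i)]].

Definition prod_except (s : nat) (gT : finGroupType) (T : 'I_s -> {group gT})
    (i : 'I_s) : {set gT} := <<\bigcup_(k < s | k != i) T k>>.

Definition zgen (s : nat) (gT : finGroupType) (T Z : 'I_s -> {group gT})
    (i : 'I_s) : gT :=
  let C := Z i :&: prod_except T i in
  odflt 1 [pick x in C | <[x]> == C].

(* a_ij = 1 iff the x_j-coordinate of z_i (w.r.t. G = T_1 x ... x T_s) is
   nontrivial, i.e. iff z_i does not lie in prod_{k<>j} T_k. *)
Definition sign_matrix (s : nat) (gT : finGroupType) (T Z : 'I_s -> {group gT})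
    (i j : 'I_s) : int :=
  if i == j then 0%R
  else if zgen T Z i \notin prod_except T j then (-1)%R else 1%R.

Definition legendre (a p : nat) : int :=
  if p %| a then 0%R
  else if [exists x : 'I_p, (x * x) %% p == a %% p] then 1%R else (-1)%R.

Definition QR_matrix (s : nat) (M : 'I_s -> 'I_s -> int) : Prop :=
  exists p : 'I_s -> nat,
    [/\ injective p, forall i, prime (p i) && odd (p i)
      & forall i j, i != j -> M i j = legendre (p i) (p j)].

Section NumberField.
Variable L : splittingFieldType rat.
Local Open Scope ring_scope.

Definition integral (x : L) : Prop :=
  exists q : {poly int}, q \is monic /\ root (map_poly (fun z : int => (z%:~R)%R) q) x.

Definition prime_ideal (P : L -> Prop) : Prop :=
  (forall x, P x -> integral x) /\
  P 0 /\
  (forall x y, P x -> P y -> P (x + y)) /\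
  (forall a x, integral a -> P x -> P (a * x)) /\
  ~ P 1 /\
  (forall x y, integral x -> integral y -> P (x * y) -> P x \/ P y) /\
  (exists x, P x /\ x <> 0).

Definition lies_over (P : L -> Prop) (p : nat) : Prop :=
  prime_ideal P /\ P (p%:R)%R.

Definition decomp_mem (P : L -> Prop) (g : gal_of {:L}) : Prop :=
  forall x, P (g x) <-> P x.

Definition inertia_mem (P : L -> Prop) (g : gal_of {:L}) : Prop :=
  decomp_mem P g /\ forall x, integral x -> P (g x - x)%R.

(* p ramifies in L iff O_L / p O_L is not reduced *)
Definition ramified (p : nat) : Prop :=
  exists (x : L) (n : nat), [/\ integral x,
     ~ (exists y, integral y /\ x = (p%:R * y)%R)
   & exists y, integral y /\ (x ^+ n = p%:R * y)%R].

(* tamely ramified: p does not divide e(P/p) = #|T(P)| (Galois case) *)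
Definition tamely_ramified : Prop :=
  forall p P, prime p -> lies_over P p ->
    exists I : {set gal_of {:L}},
      (forall g, g \in I <-> (g \in 'Gal({:L} / 1%VS) /\ inertia_mem P g))
      /\ ~~ (p %| #|I|)%N.

End NumberField.

Definition realizable (s : nat) (gT : finGroupType) (G : {group gT})
    (T Z : 'I_s -> {group gT}) : Prop :=
  exists L : splittingFieldType rat,
  [/\ galois 1%VS {:L}, tamely_ramified L &
  exists phi : {morphism 'Gal({:L} / 1%VS) >-> gT},
  isom 'Gal({:L} / 1%VS) G phi /\
  exists p : 'I_s -> nat,
    [/\ injective p, forall i, prime (p i),
        forall q, prime q -> (ramified L q <-> exists i, q = p i)
      & forall i, exists P : L -> Prop, lies_over P (p i) /\
          forall g, g \in 'Gal({:L} / 1%VS) ->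
            (phi g \in T i <-> inertia_mem P g) /\
            (phi g \in Z i <-> decomp_mem P g)]].

(* Main.v *)
Require Import Defs.
From HB Require Import structures.
From mathcomp Require Import boolp classical_sets.
From mathcomp Require Import all_boot all_order all_algebra all_fingroup all_solvable all_field.
From mathcomp Require Import mxabelem.
From mathcomp Require Import ring zify.

(** Write [p' = (-1)^((p-1)/2) p].  The realizing field must be generated by the
    square roots of [p'_1, ..., p'_s]: to each generator [x_j] belongs a quadratic
    character of the Galois group, hence a square root [m_j] of a squarefree
    integer [d_j]; the primes dividing [d_j] ramify, inertia rules out every
    [p_k] with [k <> j], and tameness at [2] forces [d_j = p'_j].
    In such a field let [E g] be the set of the [j] with [g m_j = - m_j].  At a
    prime over [p_i], inertia is the condition that [E g] be contained in [{i}],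
    and [g] lies in the decomposition group iff [E g] minus [i] is empty or equal
    to the set of the [j] for which [p'_j] is a nonresidue mod [p_i]; by quadratic
    reciprocity the latter is the set of the [j] with [(p_i / p_j) = -1].
    Taking supports identifies [G] with the subsets of [{1, ..., s}], and [Z_i]
    with the sets that, away from [i], are empty or the support of [z_i]; so the
    two descriptions agree exactly when the sign matrix is the matrix of Legendre
    symbols. *)

Set Implicit Arguments. Unset Strict Implicit. Unset Printing Implicit Defensive.
Import GRing.Theory Num.Theory.
Local Open Scope ring_scope.

(** * Quadratic reciprocity *)

(** Ramification, inertia and decomposition are tested on elements, against prime ideals obtained
    from Zorn's lemma. The common tool is the action of the Galois group on products of the square
    roots: after multiplication by 2^s, which is harmless at the odd p_i, every integral element is
    an integer combination of such products, and congruences can be checked term by term. At 2 this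
    breaks down, and the elements (1 + m_j) / 2, integral because p'_j is 1 mod 4, take over. The
    claims on small and large s rest on reciprocity alone: the entries (i, j) and (j, i) of a QR
    matrix differ exactly when p_i and p_j are both 3 mod 4, so the asymmetric pairs are all the
    pairs inside one set of indices. A single pair feels no constraint; among three indices, two
    asymmetric pairs force the third. *)

Definition qchar (p : nat) (a : 'F_p) : int :=
  if a == 0 then 0 else if [exists y : 'F_p, y ^+ 2 == a] then 1 else -1.

Definition qstar (q : nat) : int := (-1) ^+ (q.-1)./2 * q%:Z.

Section QuadraticCharacter.
Variable p : nat.
Hypotheses (pr_p : prime p) (odd_p : odd p).

Lemma odd_prime_half : (p.-1)./2.*2 = p.-1.
Proof.
by rewrite even_halfK // -subn1 oddB ?prime_gt0 // odd_p.
Qed.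

Lemma Fp_two_neq0 : (2 : 'F_p) != 0.
Proof.
by rewrite -(dvdn_pcharf (pchar_Fp pr_p)) gtnNdvd // odd_prime_gt2 //.
Qed.

Lemma qchar_eq0 (a : 'F_p) : (qchar a == 0) = (a == 0).
Proof. by rewrite /qchar; case: ifP => // _; case: ifP. Qed.

Lemma qchar_neq0 (a : 'F_p) : a != 0 -> qchar a = 1 \/ qchar a = -1.
Proof. by rewrite /qchar => /negPf ->; case: ifP; [left | right]. Qed.

Lemma qchar1P (a : 'F_p) :
  reflect (a != 0 /\ exists y : 'F_p, y ^+ 2 = a) (qchar a == 1).
Proof.
rewrite /qchar; apply: (iffP eqP) => [|[/negPf-> [y Dy]]].
  case: eqVneq => // nz_a; case: existsP => // -[y /eqP Dy] _.
  by split; last exists y.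
by case: existsP => // noy; case: noy; exists y; apply/eqP.
Qed.

Lemma Fp_unit_generator : exists g : {unit 'F_p},
  [set: {unit 'F_p}] = <[g]>%g /\ #[g]%g = p.-1.
Proof.
have /cyclicP[g Dg] := field_unit_group_cyclic [set: {unit 'F_p}]%G.
exists g; split=> //.
by rewrite orderE -Dg card_finField_unit card_Fp.
Qed.

(** The hard half is that a^((p-1)/2) = 1 makes a a square: if a = g^n for a generator g of the unit
    group, then p - 1 divides n (p-1)/2, so n is even. *)
Lemma Euler_criterion (a : 'F_p) : (qchar a)%:~R = a ^+ (p.-1)./2.
Proof.
have p_gt2 := odd_prime_gt2 odd_p pr_p.
have k_gt0: (0 < (p.-1)./2)%N by rewrite -double_gt0 odd_prime_half; case: (p) p_gt2 => [|[]].
rewrite /qchar; have [-> | nz_a] := eqVneq a 0; first by rewrite expr0n gtn_eqF.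
have Fermat (y : 'F_p) : y != 0 -> y ^+ p.-1 = 1.
  move=> nz_y; apply: (mulfI nz_y); rewrite -exprS prednK ?prime_gt0 // mulr1.
  by have := expf_card y; rewrite card_Fp.
case: ifP => [/existsP[y /eqP Dy] | noy].
  rewrite -Dy -exprM mul2n odd_prime_half Fermat //.
  by apply: contraNneq nz_a => y0; rewrite -Dy y0 expr0n.
have: (a ^+ (p.-1)./2) ^+ 2 == 1 by rewrite -exprM muln2 odd_prime_half Fermat.
rewrite sqrf_eq1 => /orP[/eqP a1 | /eqP -> //].
have [g [Dg og]] := Fp_unit_generator.
have Ua: a \is a GRing.unit by rewrite unitfE.
have [n Dn]: exists n, FinRing.unit 'F_p Ua = (g ^+ n)%g.
  by apply/cycleP; rewrite -Dg inE.
have valgX m : FinRing.uval (g ^+ m)%g = FinRing.uval g ^+ m.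
  exact: FinRing.val_unitX.
have Dan: a = FinRing.uval g ^+ n by rewrite -valgX -Dn.
have: (#[g]%g %| n * (p.-1)./2)%N.
  by rewrite order_dvdn; apply/eqP/val_inj; rewrite /= valgX exprM -Dan a1.
rewrite og -[X in (X %| _)%N]odd_prime_half -mul2n dvdn_pmul2r // dvdn2 => even_n.
case/existsP: noy; exists (FinRing.uval g ^+ n./2).
by rewrite -exprM muln2 even_halfK // Dan.
Qed.

(** As p is odd, 0, 1 and -1 stay distinct mod p; identities between values of [qchar] can thus be
    checked in ['F_p] through Euler's criterion. *)
Lemma intr_Fp_inj_sign (a b : int) :
  a \in [:: 0; 1; -1] -> b \in [:: 0; 1; -1] -> a%:~R = b%:~R :> 'F_p -> a = b.
Proof.
have n1: (1 : 'F_p) != 0 by rewrite oner_neq0.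
have n2 := Fp_two_neq0.
rewrite !inE => /or3P[] /eqP-> /or3P[] /eqP-> //= /eqP; rewrite ?mulrNz ?mulr1z ?mulr0z.
- by rewrite eq_sym oppr_eq0 (negPf n1).
- by rewrite -addr_eq0 -mulr2n (negPf n2).
- by rewrite oppr_eq0 (negPf n1).
- by rewrite eq_sym -addr_eq0 -mulr2n (negPf n2).
Qed.

Lemma qchar_sign (a : 'F_p) : qchar a \in [:: 0; 1; -1].
Proof. by rewrite /qchar; case: ifP => // _; case: ifP. Qed.

Lemma qcharM (a b : 'F_p) : qchar (a * b) = qchar a * qchar b.
Proof.
apply: intr_Fp_inj_sign; first exact: qchar_sign.
  by move: (qchar_sign a) (qchar_sign b); rewrite !inE => /or3P[] /eqP-> /or3P[] /eqP->.
by rewrite rmorphM /= !Euler_criterion exprMn.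
Qed.

Lemma qchar1 : qchar (1 : 'F_p) = 1.
Proof. by apply/eqP/qchar1P; split; [exact: oner_neq0 | exists 1; rewrite expr1n]. Qed.

Lemma qcharN1 : qchar (-1 : 'F_p) = (-1) ^+ (p.-1)./2.
Proof.
apply: intr_Fp_inj_sign; first exact: qchar_sign.
  by rewrite -signr_odd; case: odd.
by rewrite Euler_criterion rmorphXn /= rmorphN1.
Qed.

Lemma qchar_sqr (a : 'F_p) : a != 0 -> qchar a ^+ 2 = 1.
Proof. by case/qchar_neq0=> ->. Qed.

(** A generator b of the unit group is a nonresidue, its order being larger than (p-1)/2;
    multiplication by b permutes the terms and negates the sum. *)
Lemma sum_qchar : \sum_(a : 'F_p) qchar a = 0.
Proof.
have [g [_ og]] := Fp_unit_generator.
pose b := FinRing.uval g; have nz_b: b != 0 by rewrite -unitfE (valP g).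
have chb: qchar b = -1.
  have [chb1|//] := qchar_neq0 nz_b.
  have valgX m : FinRing.uval (g ^+ m)%g = b ^+ m.
    exact: FinRing.val_unitX.
  have: (#[g]%g %| (p.-1)./2)%N.
    by rewrite order_dvdn; apply/eqP/val_inj; rewrite /= valgX -Euler_criterion chb1.
  rewrite og -[X in (X %| _)%N]odd_prime_half -mul2n => /dvdn_leq.
  have: (0 < (p.-1)./2)%N.
    by rewrite -double_gt0 odd_prime_half; case: (p) (odd_prime_gt2 odd_p pr_p) => [|[]].
  by move=> k_gt0 /(_ k_gt0); rewrite -[X in (_ <= X)%N]mul1n leq_pmul2r.
set S := (LHS); have: S = - S.
  rewrite {1}/S (reindex_onto (fun a => b * a) (fun a => b^-1 * a)) /=; last first.
    by move=> a _; rewrite mulVKf.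
  rewrite -mulN1r -chb /S mulr_sumr; apply: eq_big => a; first by rewrite mulKf ?eqxx.
  by rewrite qcharM.
by move/eqP; rewrite -addr_eq0 -mulr2n mulrn_eq0 /= => /eqP.
Qed.

End QuadraticCharacter.

Lemma legendreE a p : prime p -> legendre a p = qchar (a%:R : 'F_p).
Proof.
move=> pr_p; have cp := pchar_Fp pr_p.
rewrite /legendre /qchar -(dvdn_pcharf cp); case: ifP => // _.
congr (if _ then _ else _); apply/existsP/existsP=> [[x /eqP Dx] | [y /eqP Dy]].
  exists (x : nat)%:R; apply/eqP; apply: val_inj.
  by rewrite -natrX /= !val_Fp_nat // -mulnn.
have lt_y: (y < p)%N by rewrite -[X in (_ < X)%N](Fp_cast pr_p) ltn_ord.
exists (Ordinal lt_y); apply/eqP; rewrite /= -!(val_Fp_nat pr_p).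
by congr val; rewrite natrM -expr2 natr_Zp.
Qed.

(** * Gauss sums in characteristic p *)

Section GaussSum.
Variables (p q : nat).
Hypotheses (pr_p : prime p) (odd_p : odd p) (pr_q : prime q) (odd_q : odd q).
Hypothesis neq_pq : p != q.

Variables (K : splittingFieldType 'F_p) (w : K).
Hypotheses (wq1 : w ^+ q = 1) (w_neq1 : w != 1).

Let z (a : 'F_q) : K := w ^+ a.
Let tau : K := \sum_(a : 'F_q) (qchar a)%:~R * z a.

Let zn (n : nat) : z n%:R = w ^+ n.
Proof. by rewrite /z val_Fp_nat // expr_mod. Qed.

Let zD a b : z (a + b) = z a * z b.
Proof. by rewrite -(natr_Zp a) -(natr_Zp b) -natrD !zn exprD. Qed.

Let charK : p \in [pchar K].
Proof.
have := pchar_Fp pr_p; rewrite !inE => /andP[-> /eqP p0].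
by rewrite -[p%:R]scaler_nat p0 scale0r eqxx.
Qed.

Let sum_z : \sum_a z a = 0.
Proof.
have /eqP: (\sum_a z a) * (z 1 - 1) = 0.
  rewrite mulrBr mulr1 mulr_suml [X in _ - X](reindex_inj (addIr 1)) /=.
  by apply/eqP; rewrite subr_eq0; apply/eqP/eq_bigr => a _; rewrite zD.
by rewrite mulf_eq0 subr_eq0 (zn 1) expr1 (negPf w_neq1) orbF => /eqP.
Qed.

Let sum_zM c : \sum_a z (a * c) = (if c == 0 then q%:R else 0).
Proof.
have [-> | nz_c] := eqVneq c 0.
  rewrite (eq_bigr (fun=> 1)) ?sumr_const ?card_Fp // => a _.
  by rewrite mulr0 (zn 0) expr0.
rewrite (reindex_onto (fun a => a / c) (fun a => a * c)) /=; last first.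
  by move=> a _; rewrite mulfK.
by rewrite -[RHS]sum_z; apply: eq_big => a; rewrite divfK // eqxx.
Qed.

(** Put b = a c in the double sum. The sum of z (a (1 + c)) over all a is q for c = -1 and 0
    otherwise; the missing terms a = 0 contribute the sum of [qchar], which vanishes. What remains
    is q times the symbol of -1. *)
Lemma sqr_gauss_sum : tau ^+ 2 = (qstar q)%:~R.
Proof.
have: tau ^+ 2 = \sum_(a | a != 0) \sum_c (qchar c)%:~R * z (a * (1 + c)).
  rewrite expr2 {1}/tau mulr_suml (bigD1 0) //= {1}/qchar eqxx mulr0z !mul0r add0r.
  apply: eq_bigr => a nz_a; rewrite /tau mulr_sumr.
  rewrite (reindex_onto (fun c => a * c) (fun b => a^-1 * b)) /=; last first.
    by move=> b _; rewrite mulVKf.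
  apply: eq_big => c; first by rewrite mulKf ?eqxx.
  move=> _; rewrite qcharM // mulrACA -rmorphM /= [qchar a * (_ * _)]mulrA.
  by rewrite -expr2 qchar_sqr // mul1r -zD mulrDr mulr1.
move->; rewrite exchange_big /= (eq_bigr (fun c =>
   (qchar c)%:~R * (if 1 + c == 0 then q%:R else 0) - (qchar c)%:~R)); last first.
  move=> c _; rewrite -sum_zM (bigD1 0 (P := predT)) //= mul0r (zn 0) expr0 mulrDr mulr1.
  by rewrite addrAC subrr add0r mulr_sumr.
rewrite sumrB -[X in _ - X]rmorph_sum /= sum_qchar // subr0.
rewrite (bigD1 (-1)) //= subrr eqxx big1 => [|c]; last first.
  by rewrite -subr_eq0 opprK addrC => /negPf ->; rewrite mulr0.
by rewrite addr0 qcharN1 // /qstar rmorphM.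
Qed.

(** Frobenius fixes the integer coefficients and sends z a to z (p a); reindexing brings out the
    symbol of p. *)
Let gauss_sum_frob : tau ^+ p = (qchar (p%:R : 'F_q))%:~R * tau.
Proof.
have np0: (p%:R : 'F_q) != 0.
  by rewrite -(dvdn_pcharf (pchar_Fp pr_q)) dvdn_prime2 // eq_sym.
rewrite -(pFrobenius_autE charK) rmorph_sum /= /tau mulr_sumr.
rewrite [RHS](reindex_onto (fun a => p%:R * a) (fun b => p%:R^-1 * b)) /=; last first.
  by move=> b _; rewrite mulVKf.
apply: eq_big => a; first by rewrite mulKf ?eqxx.
move=> _; rewrite rmorphM /= rmorph_int qcharM // mulrA -rmorphM /=.
rewrite [X in _ = X%:~R * _]mulrA -expr2 qchar_sqr // mul1r; congr (_ * _).
rewrite pFrobenius_autE /z -exprM -[LHS](zn (a * p)).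
by rewrite natrM natr_Zp mulrC.
Qed.

(** As [tau] is a square root of [qstar q], the latter is a square mod p iff [tau] lies in the prime
    field, that is iff tau^p = tau; by [gauss_sum_frob] this says that p is a residue mod q. *)
Lemma gauss_sum_reciprocity :
  (qchar ((qstar q)%:~R : 'F_p) == 1) = (qchar (p%:R : 'F_q) == 1).
Proof.
have n2 := Fp_two_neq0 pr_p odd_p.
have n2K: (2 : K) != 0.
  by rewrite -(dvdn_pcharf charK) gtnNdvd // odd_prime_gt2 //.
have q0: (q%:R : 'F_p) != 0.
  by rewrite -(dvdn_pcharf (pchar_Fp pr_p)) dvdn_prime2.
have nzq: ((qstar q)%:~R : 'F_p) != 0.
  by rewrite rmorphM rmorphXn /= rmorphN1 mulf_neq0 // signr_eq0.
have inK (m : int) : (m%:~R : 'F_p)%:A = m%:~R :> K.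
  by rewrite -[LHS]/(in_alg K _) rmorph_int.
have nzt: tau != 0.
  by rewrite -sqrf_eq0 sqr_gauss_sum -inK -[_%:A]/(in_alg K _) fmorph_eq0.
have np0: (p%:R : 'F_q) != 0.
  by rewrite -(dvdn_pcharf (pchar_Fp pr_q)) dvdn_prime2 // eq_sym.
have FpP: (tau \in 1%VS) = (tau ^+ p == tau).
  have := Fermat's_little_theorem (1%AS : {subfield K}) tau.
  by rewrite /= dimv1 expn1 card_Fp.
have Frob1: (tau ^+ p == tau) = (qchar (p%:R : 'F_q) == 1).
  rewrite gauss_sum_frob; case: (qchar_neq0 np0) => ->; rewrite ?mul1r ?eqxx //.
  rewrite mulrNz mulN1r eq_sym -addr_eq0 -mulr2n -mulr_natl mulf_eq0 (negPf n2K).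
  by rewrite (negPf nzt).
rewrite -Frob1 -FpP; apply/qchar1P/idP => [[_ [y Dy]] | /vlineP[y Dy]].
  have: tau ^+ 2 == (y%:A) ^+ 2.
    by rewrite sqr_gauss_sum -inK -Dy -[_%:A in X in X == _]/(in_alg K _) rmorphXn.
  by rewrite eqf_sqr => /orP[]/eqP->; rewrite ?rpredN rpredZ // mem1v.
split=> //; exists y; apply: (fmorph_inj (in_alg K)); rewrite rmorphXn /= -Dy.
by rewrite sqr_gauss_sum inK.
Qed.

End GaussSum.

(** Any root of 1 + X + ... + X^(q-1) serves: at 1 this polynomial takes the value q, which is
    nonzero mod p. *)
Lemma prime_root_of_unity (p q : nat) : prime p -> prime q -> p != q ->
  exists (K : splittingFieldType 'F_p) (w : K), w ^+ q = 1 /\ w != 1.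
Proof.
move=> pr_p pr_q neq_pq.
pose f : {poly 'F_p} := \sum_(i < q) 'X^i.
have sz_f: size f = q.
  have ->: f = \poly_(i < q) 1.
    by rewrite poly_def; apply: eq_bigr => i _; rewrite scale1r.
  by rewrite size_poly_eq ?oner_neq0.
have nz_f: f != 0 by rewrite -size_poly_gt0 sz_f prime_gt0.
have [K [rs Drs _]] := FinSplittingFieldFor nz_f.
case: rs Drs => [|w rs] Drs.
  move: (eqp_size Drs); rewrite size_map_poly sz_f big_nil size_polyC oner_neq0.
  by move=> q1; rewrite q1 in pr_q.
exists K, w; have: root (map_poly (in_alg K) f) w.
  by rewrite (eqp_root Drs) root_prod_XsubC mem_head.
rewrite rmorph_sum /= /root horner_sum => /eqP fw0.
have fw: \sum_(i < q) w ^+ i = 0.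
  by rewrite -[RHS]fw0; apply: eq_bigr => i _; rewrite map_polyXn hornerXn.
split; first by apply/eqP; rewrite -subr_eq0 subrX1 fw mulr0.
apply: contra_eqN fw => /eqP ->.
under eq_bigr do rewrite expr1n.
rewrite sumr_const card_ord -scaler_nat -[_ *: _]/(in_alg K _) fmorph_eq0.
by rewrite -(dvdn_pcharf (pchar_Fp pr_p)) dvdn_prime2.
Qed.

Theorem quadratic_reciprocity (p q : nat) :
  prime p -> odd p -> prime q -> odd q -> p != q ->
  (qchar ((qstar q)%:~R : 'F_p) == 1) = (qchar (p%:R : 'F_q) == 1).
Proof.
move=> pr_p odd_p pr_q odd_q neq_pq.
have [K [w [wq w1]]] := prime_root_of_unity pr_p pr_q neq_pq.
exact: (gauss_sum_reciprocity pr_p odd_p pr_q odd_q neq_pq wq w1).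
Qed.

(** * Integral elements and prime ideals *)

Section Integral.
Variable L : splittingFieldType rat.
Implicit Types (x y : L) (g : gal_of {:L}).

Lemma integralP x : integral x <-> integralOver (intr : int -> L) x.
Proof. by split=> [[q [mq rq]] | [q mq rq]]; exists q. Qed.

Lemma integral_intr (k : int) : integral (k%:~R : L).
Proof. by apply/integralP; exact: (integral_id (intr : {rmorphism int -> L})). Qed.

Lemma integral_natr (k : nat) : integral (k%:R : L).
Proof. exact: (integral_intr k%:Z). Qed.

Lemma integralD x y : integral x -> integral y -> integral (x + y).
Proof. by move=> /integralP ix /integralP iy; apply/integralP; exact: integral_add. Qed.

Lemma integralB x y : integral x -> integral y -> integral (x - y).
Proof. by move=> /integralP ix /integralP iy; apply/integralP; exact: integral_sub. Qed.

Lemma integralM x y : integral x -> integral y -> integral (x * y).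
Proof. by move=> /integralP ix /integralP iy; apply/integralP; exact: integral_mul. Qed.

Lemma integralX x n : integral x -> integral (x ^+ n).
Proof.
move=> ix; elim: n => [|n IHn]; first exact: (integral_intr 1).
by rewrite exprS; exact: integralM.
Qed.

Lemma integral_bigsum (I : Type) (r : seq I) (Q : pred I) (F : I -> L) :
  (forall i, Q i -> integral (F i)) -> integral (\sum_(i <- r | Q i) F i).
Proof. by move=> iF; elim/big_ind: _; [exact: (integral_intr 0) | exact: integralD |]. Qed.

Lemma integral_bigprod (I : Type) (r : seq I) (Q : pred I) (F : I -> L) :
  (forall i, Q i -> integral (F i)) -> integral (\prod_(i <- r | Q i) F i).
Proof. by move=> iF; elim/big_ind: _; [exact: (integral_intr 1) | exact: integralM |]. Qed.

Lemma integral_gal g x : integral x -> integral (g x).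
Proof.
case=> q [mq /rootP rq]; exists q; split=> //; apply/rootP.
have := congr1 (fun y => g y) rq; rewrite /= rmorph0 -horner_map /= => rgq.
rewrite -[RHS]rgq; congr (_.[_]); apply/polyP => i.
by rewrite !coef_map /= rmorph_int.
Qed.

(** The question is moved to [algC], where rational algebraic integers are known to be integers. *)
Lemma integral_rat x : integral x -> x \in 1%VS -> exists k : int, x = k%:~R.
Proof.
case=> q [mq rq] /vlineP[r Dx].
have /intrP[k Dk]: (ratr r : algC) \is a Num.int.
  apply: Cint_rat_Aint; first exact: Crat_rat.
  apply: (@root_monic_Aint (map_poly intr q)).
  - move: rq; rewrite Dx -[_%:A]/(in_alg L r) => rq.
    have {}rq: root (map_poly (in_alg L) (map_poly intr q)) (in_alg L r).
      rewrite -map_poly_comp; congr (root _ _): rq; apply: eq_map_poly => k /=.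
      by rewrite -[RHS]/(in_alg L _) rmorph_int.
    move: rq; rewrite fmorph_root => rq.
    have: root (map_poly (ratr : rat -> algC) (map_poly intr q)) (ratr r).
      by rewrite fmorph_root.
    rewrite -map_poly_comp; congr (root _ _); apply: eq_map_poly => k /=.
    by rewrite rmorph_int.
  - by rewrite monic_map.
  by apply/polyOverP => i; rewrite coef_map /= intr_int.
exists k; rewrite Dx.
have ->: r = k%:~R.
  by apply: (fmorph_inj (ratr : {rmorphism rat -> algC})); rewrite /= Dk rmorph_int.
by rewrite -[LHS]/(in_alg L _) rmorph_int.
Qed.

Lemma intrL_inj : injective (fun k : int => k%:~R : L).
Proof.
move=> k l /= eq_kl; have /(fmorph_inj (in_alg L)) /eqP: in_alg L k%:~R = in_alg L l%:~R.
  by rewrite !rmorph_int.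
by rewrite eqr_int => /eqP.
Qed.

Lemma intrL_eq0 (k : int) : (k%:~R == 0 :> L) = (k == 0).
Proof. by rewrite -(inj_eq intrL_inj). Qed.

Lemma mem_Gal1 g : g \in 'Gal({:L} / 1)%g.
Proof.
rewrite gal_kHom ?sub1v //; apply/kAHomP => a /vlineP[k ->].
by rewrite linearZ /= rmorph1.
Qed.

Hypothesis galL : galois 1 {:L}.

Lemma fixed_gal_rat x : (forall g, g x = x) -> x \in 1%VS.
Proof.
by move=> fx; rewrite -(galois_fixedField galL); apply/fixedFieldP; rewrite ?memvf.
Qed.

Lemma fixed_gal_int x : integral x -> (forall g, g x = x) -> exists k : int, x = k%:~R.
Proof. by move=> ix /fixed_gal_rat; exact: integral_rat. Qed.

End Integral.

Section PrimeIdeal.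
Variables (L : splittingFieldType rat) (P : L -> Prop) (p : nat).
Hypotheses (pr_p : prime p) (Pp : lies_over P p).
Implicit Types (x y : L).

Lemma ideal_integral x : P x -> integral x.
Proof. by case: Pp => [[iP _] _]; exact: iP. Qed.

Lemma ideal0 : P 0.
Proof. by case: Pp => [[_ []]]. Qed.

Lemma idealD x y : P x -> P y -> P (x + y).
Proof. by case: Pp => [[_ [_ [PD _]]] _]; exact: PD. Qed.

Lemma ideal_mull a x : integral a -> P x -> P (a * x).
Proof. by case: Pp => [[_ [_ [_ [PM _]]]] _]; exact: PM. Qed.

Lemma ideal_mulr a x : integral a -> P x -> P (x * a).
Proof. by rewrite mulrC; exact: ideal_mull. Qed.

Lemma idealN x : P x -> P (- x).
Proof. by rewrite -mulN1r; apply: ideal_mull; exact: (integral_intr _ (-1)). Qed.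

Lemma idealB x y : P x -> P y -> P (x - y).
Proof. by move=> Px Py; apply: idealD => //; exact: idealN. Qed.

Lemma ideal_prime x y : integral x -> integral y -> P (x * y) -> P x \/ P y.
Proof. by case: Pp => [[_ [_ [_ [_ [_ [Ppr _]]]]]] _]; exact: Ppr. Qed.

Lemma ideal_sqr x : integral x -> P (x ^+ 2) -> P x.
Proof. by move=> ix; rewrite expr2 => /ideal_prime[]. Qed.

Lemma ideal_pow x n : integral x -> P (x ^+ n) -> P x.
Proof.
move=> ix; elim: n => [|n IHn]; first by case: Pp => [[_ [_ [_ [_ [P1 _]]]]] _] /P1.
by rewrite exprS => /ideal_prime[] //; exact: integralX.
Qed.

Lemma ideal_bigsum (I : Type) (r : seq I) (Q : pred I) (F : I -> L) :
  (forall i, Q i -> P (F i)) -> P (\sum_(i <- r | Q i) F i).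
Proof. by move=> PF; elim/big_ind: _; [exact: ideal0 | exact: idealD |]. Qed.

(** An integer of P prime to p would, by Bezout, put 1 in P. *)
Lemma ideal_intr (k : int) : P k%:~R <-> (p%:Z %| k)%Z.
Proof.
have PpL: P p%:R by case: Pp.
split=> [Pk | /dvdzP[l ->]]; last first.
  by rewrite rmorphM; apply: ideal_mull => //; exact: integral_intr.
apply: contraT => Npk; have: coprimez p%:Z k.
  by rewrite coprimezE /= prime_coprime.
case/coprimezP=> -[u v] /= Duv; case: Pp => [[_ [_ [_ [_ [P1 _]]]]] _].
case: P1; rewrite -[1](mulr1z) -Duv rmorphD !rmorphM /=.
by apply: idealD; apply: ideal_mull => //; exact: integral_intr.
Qed.

Lemma ideal_two x : odd p -> integral x -> P (x *+ 2) -> P x.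
Proof.
move=> odd_p ix; rewrite -mulr_natl => /ideal_prime[] //; first exact: integral_natr.
by move/(ideal_intr 2%:Z); rewrite dvdzE /= dvdn_prime2 // => /eqP p2; rewrite p2 in odd_p.
Qed.

End PrimeIdeal.

(** * Existence of a prime ideal over p *)

Section PrimeExists.
Local Open Scope classical_set_scope.
Variables (L : splittingFieldType rat) (p : nat).
Hypothesis pr_p : prime p.

Let proper_ideal (A : set L) :=
  [/\ A `<=` @integral L, A p%:R, forall x y, A x -> A y -> A (x + y),
      forall a x, integral a -> A x -> A (a * x) & ~ A 1].

(** An ideal maximal among the proper ones containing p is prime. The principal ideal of p is proper
    because 1/p is rational but not an integer; this also shows that the maximal set is not
    empty. *)
Lemma prime_over_exists : exists P : L -> Prop, lies_over P p.
Proof.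
(* The empty set is admitted because [Zorn_bigcup] ranges over the empty chain too. *)
pose Q (A : set L) := A = classical_sets.set0 \/ proper_ideal A.
have nz_p: (p%:R : L) != 0 by rewrite (intrL_eq0 L p%:Z) eqz_nat -lt0n prime_gt0.
have [|A [QA maxA]] := @Zorn_bigcup _ Q.
  move=> F FQ totF; have [[X FX [z Xz]] | noX] :=
    pselect (exists2 X, F X & X !=set0); last first.
    left; rewrite -classical_sets.subset0 => z [X FX Xz]; case: noX; exists X => //; by exists z.
  have properF Y y : F Y -> Y y -> proper_ideal Y.
    by move=> FY Yy; have [Y0|//] := FQ _ FY; rewrite Y0 in Yy.
  right; split.
  - by move=> y [Y FY Yy]; have [iY _ _ _ _] := properF _ _ FY Yy; exact: iY.
  - by exists X => //; have [] := properF _ _ FX Xz.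
  - move=> x y [Y FY Yx] [Z FZ Zy].
    have [YZ | ZY] := totF _ _ FY FZ.
      by exists Z => //; have [_ _ ZD _ _] := properF _ _ FZ Zy; apply: ZD => //; exact: YZ.
    by exists Y => //; have [_ _ YD _ _] := properF _ _ FY Yx; apply: YD => //; exact: ZY.
  - move=> a x ia [Y FY Yx]; exists Y => //.
    by have [_ _ _ YM _] := properF _ _ FY Yx; exact: YM.
  - by case=> Y FY Y1; have [_ _ _ _] := properF _ _ FY Y1.
have pidP: proper_ideal [set x | exists2 y, integral y & x = p%:R * y].
  split=> [x [y iy ->] | | x y [u iu ->] [v iv ->] | a x ia [y iy ->] | [y iy D1]].
  - by apply: integralM => //; exact: integral_natr.
  - by exists 1; rewrite ?mulr1 //; exact: (integral_intr _ 1).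
  - by exists (u + v); rewrite ?mulrDr //; exact: integralD.
  - by exists (a * y); rewrite 1?mulrCA //; exact: integralM.
  have: y \in 1%VS.
    have ->: y = (p%:R^-1 : rat)%:A.
      apply: (mulfI nz_p); rewrite -D1 -[_%:A]/(in_alg L _).
      rewrite -(rmorph_nat (in_alg L)) -rmorphM /=.
      by rewrite divff ?scale1r // pnatr_eq0 -lt0n prime_gt0.
    by rewrite rpredZ // mem1v.
  move/(integral_rat iy) => [k Dk].
  have: (1 : int) = p%:Z * k by apply: (@intrL_inj L); rewrite /= rmorphM /= -Dk -D1.
  move/(congr1 absz); rewrite abszM /= => /esym/eqP; rewrite muln_eq1 => /andP[/eqP p1 _].
  by move: pr_p; rewrite p1.
have [A0 | [iA Ap AD AM A1]] := QA.
  case: (maxA _ _ (or_intror pidP)); rewrite A0; split=> [z [] //|/(_ 0)[]].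
  by exists 0; rewrite ?mulr0 //; exact: (integral_intr _ 0).
have A0: A 0 by rewrite -(mul0r p%:R); apply: AM => //; exact: (integral_intr _ 0).
exists A; split=> //; do ![split=> //]; last by exists p%:R; split=> //; exact/eqP.
move=> x y ix iy Axy; have [Ax | nAx] := pselect (A x); [by left | right].
(* The ideal generated by A and x exceeds A, hence contains 1; multiplying 1 = a + b x by y puts y
   in A. *)
pose B := [set z | exists a b, [/\ A a, integral b & z = a + b * x]].
have AB: A `<` B.
  split=> [z Az | BA]; first exists z, 0.
    by rewrite mul0r addr0; split=> //; exact: (integral_intr _ 0).
  apply/nAx/BA; exists 0, 1.
  by rewrite mul1r add0r; split=> //; exact: (integral_intr _ 1).
have [a [b [Aa ib D1]]]: B 1.
  apply: contrapT => nB1; apply: (maxA _ AB); right; split=> //.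
  - move=> z [a [b [Aa ib ->]]]; apply: integralD; first exact: iA.
    exact: integralM.
  - by case: AB => AB _; exact: AB.
  - move=> u v [a [b [Aa ib ->]]] [a' [b' [Aa' ib' ->]]]; exists (a + a'), (b + b').
    by split; [exact: AD | exact: integralD | ring].
  - move=> c u ic [a [b [Aa ib ->]]]; exists (c * a), (c * b).
    by split; [exact: AM | exact: integralM | ring].
rewrite -[y]mul1r D1 mulrDl -mulrA; apply: AD; last exact: AM.
by rewrite mulrC; exact: AM.
Qed.

End PrimeExists.

(** * Multiquadratic fields *)

Lemma Fp_intr_eq0 (p : nat) (k : int) : prime p ->
  ((k%:~R : 'F_p) == 0) = (p%:Z %| k)%Z.
Proof.
move=> pr_p; have cp := pchar_Fp pr_p.
rewrite dvdzE /= (dvdn_pcharf cp).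
by case: (intP k) => [|n|n] //=; rewrite ?mulrNz ?oppr_eq0.
Qed.

Lemma prod_distinct_primes_dvdn (I : finType) (p : I -> nat) (A : {set I}) n :
  injective p -> (forall i, prime (p i)) -> (forall i, i \in A -> (p i %| n)%N) ->
  (\prod_(i in A) p i %| n)%N.
Proof.
move=> pI pr_p pAn; rewrite -big_enum /=.
have: uniq (enum A) := enum_uniq A.
have: {in enum A, forall i, (p i %| n)%N} by move=> i; rewrite mem_enum; exact: pAn.
elim: (enum A) => [|i r IHr] pr /=; first by rewrite big_nil dvd1n.
case/andP=> r'i Ur; rewrite big_cons Gauss_dvd.
  rewrite pr ?mem_head //=; apply: IHr => // j rj.
  by apply: pr; rewrite inE rj orbT.
rewrite big_seq; elim/big_ind: _ => [|a b|j rj]; first exact: coprimen1.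
  by rewrite coprimeMr => -> ->.
rewrite prime_coprime // dvdn_prime2 // (inj_eq pI).
by apply: contraNneq r'i => ->.
Qed.

Lemma dvdz_qstar (q p : nat) : (q%:Z %| qstar p)%Z = (q %| p)%N.
Proof. by rewrite /qstar dvdzE abszM abszX /= exp1n mul1n. Qed.

Lemma absz_qstar (p : nat) : `|qstar p|%N = p.
Proof. by rewrite /qstar abszM abszX /= exp1n mul1n. Qed.

Lemma qstar_mod4 (p : nat) : odd p -> exists k : int, 1 - qstar p = 4 * k.
Proof.
move=> odd_p; have [n Dn]: exists n, p = n.*2.+1.
  by exists p./2; rewrite -[LHS]odd_double_half odd_p.
rewrite /qstar Dn /= doubleK; have [k [b ->]]: exists k (b : bool), n = (b + k.*2)%N.
  by exists n./2, (odd n); rewrite odd_double_half.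
rewrite -signr_odd oddD odd_double addbF oddb.
by case: b => /=; [exists k.+1%:Z | exists (- k%:Z)]; rewrite ?expr1 ?expr0; lia.
Qed.

(** The element m is nilpotent mod q, and nonzero there: if m = q y, then y^2 = d / q^2 is rational
    and integral, so q^2 divides d. *)
Lemma ramified_sqrt (L : splittingFieldType rat) (m : L) (d : int) (q : nat) :
  m ^+ 2 = d%:~R -> (q%:Z %| d)%Z -> ~~ ((q%:Z ^+ 2)%R %| d)%Z -> q != 0%N -> ramified L q.
Proof.
move=> m2 q_d q2'd nz_q.
exists m, 2; split.
- exists ('X^2 - d%:P); split; first exact: monicXnsubC.
  by rewrite rmorphB /= map_polyXn map_polyC /= /root !hornerE m2 subrr.
- case=> y [iy Dm].
  have nzq: (q%:R : L) != 0 by rewrite (intrL_eq0 L q%:Z) eqz_nat.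
  have Dy: y ^+ 2 = d%:~R / q%:R ^+ 2.
    by apply: (mulfI (expf_neq0 2 nzq)); rewrite -exprMn -Dm m2 mulrC divfK // expf_neq0.
  have [k Dk]: exists k : int, y ^+ 2 = k%:~R.
    apply: integral_rat; first exact: integralX.
    by rewrite Dy -[1%VS]/(1%AS : {vspace L}) rpred_div ?rpredX ?rpred_int ?rpred_nat.
  case/negP: q2'd; apply/dvdzP; exists k; apply: (@intrL_inj L).
  by rewrite /= -m2 Dm exprMn Dk rmorphM /= rmorphXn /= mulrC.
have [k Dk] := dvdzP q_d; exists k%:~R; split; first exact: integral_intr.
by rewrite m2 Dk rmorphM mulrC.
Qed.

Lemma qchar_qstar (p q : nat) :
  prime p -> odd p -> prime q -> odd q -> p != q ->
  qchar ((qstar q)%:~R : 'F_p) = legendre p q.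
Proof.
move=> pr_p odd_p pr_q odd_q neq_pq; rewrite legendreE //.
have /qchar_neq0 q0: ((qstar q)%:~R : 'F_p) != 0.
  by rewrite Fp_intr_eq0 // dvdz_qstar dvdn_prime2.
have /qchar_neq0 p0: (p%:R : 'F_q) != 0.
  by rewrite -(dvdn_pcharf (pchar_Fp pr_q)) dvdn_prime2 // eq_sym.
have := quadratic_reciprocity pr_p odd_p pr_q odd_q neq_pq.
by case: q0 p0 => -> [] ->.
Qed.

(** If a^2 = d mod p, then (M - a) (M + a) lies in P. *)
Lemma ideal_sqrt_mod (L : splittingFieldType rat) (P : L -> Prop) (p : nat) (M : L) (d : int) :
  prime p -> lies_over P p -> integral M -> M ^+ 2 = d%:~R ->
  qchar (d%:~R : 'F_p) = 1 -> exists a : int, P (M - a%:~R).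
Proof.
move=> pr_p Pp iM M2 /eqP/qchar1P[_ [y Dy]].
pose a : int := (y : nat)%:Z.
have: P ((M - a%:~R) * (M + a%:~R)).
  have ->: (M - a%:~R) * (M + a%:~R) = (d - a ^+ 2)%:~R.
    by rewrite rmorphB rmorphXn /= -M2; ring.
  apply/(ideal_intr pr_p Pp); rewrite -Fp_intr_eq0 // rmorphB rmorphXn /= -Dy.
  by rewrite [_%:~R](natr_Zp y) subrr.
case/(ideal_prime Pp); last 2 [by exists a] => [||PM].
- by apply: integralB => //; exact: integral_intr.
- by apply: integralD => //; exact: integral_intr.
by exists (- a); rewrite rmorphN opprK.
Qed.

(** * Galois action on products of square roots *)

Section MultiQuadratic.
Variables (L : splittingFieldType rat) (s : nat) (p : 'I_s -> nat) (m : 'I_s -> L).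
Hypothesis galL : galois 1 {:L}.
Hypotheses (p_inj : injective p) (pr_p : forall i, prime (p i)) (odd_p : forall i, odd (p i)).
Hypothesis m_sqr : forall i, m i ^+ 2 = (qstar (p i))%:~R.
Hypothesis m_sep : forall g : gal_of {:L}, (forall i, g (m i) = m i) -> g = 1%g.
Implicit Types (g h : gal_of {:L}) (A : {set 'I_s}) (x : L).

(** This is the set E g of the overview. Since L is Galois, [m_sep] expresses that the [m i]
    generate it. *)
Definition moved g : {set 'I_s} := [set j | g (m j) != m j].
Let eps g j : int := (-1) ^+ (j \in moved g).
(** For fixed A, [sg _ A] is a character of the Galois group with values 1 and -1, and [mm A] is an
    eigenvector for it, with squarefree square [dd A]. *)
Let sg g A : int := \prod_(j in A) eps g j.
Let mm A : L := \prod_(j in A) m j.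
Let dd A : int := \prod_(j in A) qstar (p j).

Lemma integral_sqrt j : integral (m j).
Proof.
exists ('X^2 - (qstar (p j))%:P); split; first exact: monicXnsubC.
by rewrite rmorphB /= map_polyXn map_polyC /= /root !hornerE m_sqr subrr.
Qed.

Lemma sqrt_neq0 j : m j != 0.
Proof.
rewrite -sqrf_eq0 m_sqr intrL_eq0 -absz_eq0 absz_qstar -lt0n.
exact: prime_gt0.
Qed.

Let gm g j : g (m j) = (eps g j)%:~R * m j.
Proof.
rewrite /eps inE; have [-> | neq] := eqVneq (g (m j)) (m j); first by rewrite mul1r.
have: g (m j) ^+ 2 == m j ^+ 2 by rewrite -rmorphXn /= m_sqr rmorph_int.
by rewrite eqf_sqr (negPf neq) /= => /eqP ->; rewrite mulN1r.
Qed.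

Let galMx g h x : (g * h)%g x = h (g x).
Proof. by rewrite galM ?memvf. Qed.

Let epsE g j k : g (m j) = k%:~R * m j -> eps g j = k.
Proof. by rewrite gm => /(mulIf (sqrt_neq0 j)) /intrL_inj. Qed.

Let epsM g h j : eps (g * h)%g j = eps g j * eps h j.
Proof. by apply: epsE; rewrite galMx gm rmorphM /= rmorph_int gm mulrA rmorphM. Qed.

Let eps_sqr g j : eps g j * eps g j = 1.
Proof. by rewrite /eps -expr2 sqrr_sign. Qed.

Let sgM g h A : sg (g * h)%g A = sg g A * sg h A.
Proof. by rewrite /sg -big_split; apply: eq_bigr => j _; exact: epsM. Qed.

Let sg_sqr g A : sg g A * sg g A = 1.
Proof. by rewrite /sg -big_split big1 //= => j _; exact: eps_sqr. Qed.

Let gmm g A : g (mm A) = (sg g A)%:~R * mm A.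
Proof.
rewrite /mm rmorph_prod /= (eq_bigr _ (fun j _ => gm g j)) big_split /=.
by rewrite -rmorph_prod.
Qed.

Let mm_sqr A : mm A ^+ 2 = (dd A)%:~R.
Proof.
rewrite -prodrXl rmorph_prod /=; apply: eq_bigr => j _; exact: m_sqr.
Qed.

Let integral_mm A : integral (mm A).
Proof. by apply: integral_bigprod => j _; exact: integral_sqrt. Qed.

Let absz_dd A : `|dd A|%N = (\prod_(j in A) p j)%N.
Proof.
rewrite /dd (big_morph absz abszM (erefl _)).
by apply: eq_bigr => j _; rewrite absz_qstar.
Qed.

Let dd_neq0 A : dd A != 0.
Proof.
rewrite -absz_eq0 absz_dd -lt0n prodn_cond_gt0 // => j _; exact: prime_gt0.
Qed.

Lemma movedM g h : moved (g * h)%g = [set j | (j \in moved g) (+) (j \in moved h)].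
Proof.
apply/setP=> j; rewrite [RHS]in_set; apply: (@signr_inj int).
by rewrite signr_addb; exact: epsM.
Qed.

Lemma moved_inj : injective moved.
Proof.
move=> g h eq_gh; have eq_eps j : eps g j = eps h j by rewrite /eps eq_gh.
have fix1 (k : gal_of {:L}) : (k * k = 1)%g.
  by apply: m_sep => j; rewrite gm epsM eps_sqr mul1r.
have gh1: (g * h = 1)%g.
  by apply: m_sep => j; rewrite gm epsM eq_eps eps_sqr mul1r.
by apply: (mulIg h); rewrite gh1 fix1.
Qed.

Lemma gal_involutive g x : g (g x) = x.
Proof.
rewrite -galMx; have ->: (g * g = 1)%g; last exact: gal_id.
by apply: m_sep => j; rewrite gm epsM eps_sqr mul1r.
Qed.

Lemma moved_eq0 g : moved g = set0 -> g = 1%g.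
Proof.
move=> Mg; apply: m_sep => j; apply/eqP; have := in_set0 j.
by rewrite -Mg inE => /negbFE.
Qed.

(** The sum expands the product of the [eps g j] + 1, in which each moved [m j] gives a zero
    factor. *)
Let sum_sg g : \sum_A sg g A = if g == 1%g then 2 ^+ s else 0.
Proof.
have ->: \sum_A sg g A = \prod_(j < s) (eps g j + 1).
  rewrite bigA_distr; apply: eq_big => // A _; rewrite /sg big_mkcond /=.
  by apply: eq_bigr.
have [-> | ntg] := eqVneq g 1%g.
  rewrite (eq_bigr (fun=> 2)) ?prodr_const ?card_ord // => j _.
  by rewrite /eps inE gal_id eqxx.
have [j Mj]: exists j, j \in moved g.
  by apply/set0Pn; apply: contraNneq ntg => /moved_eq0 ->.
by rewrite (bigD1 j) //= /eps Mj addNr mul0r.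
Qed.

(* The [A]-isotypic component of [x] is a rational multiple of [mm A]; as [dd A]
   is squarefree, integrality of the component makes the multiple an integer. *)
Let expand x : integral x -> exists c : {set 'I_s} -> int, forall g,
  2 ^+ s * g x = \sum_A (c A * sg g A)%:~R * mm A.
Proof.
move=> ix; pose e A : L := \sum_g (sg g A)%:~R * g x.
have ie A : integral (e A).
  apply: integral_bigsum => g _; apply: integralM; first exact: integral_intr.
  exact: integral_gal.
have ge h A : h (e A) = (sg h A)%:~R * e A.
  rewrite /e rmorph_sum mulr_sumr [RHS](reindex_inj (mulIg h)) /=.
  apply: eq_bigr => g _; rewrite galMx sgM rmorphM /= rmorph_int mulrA -rmorphM /=.
  by rewrite mulrCA sg_sqr mulr1.
have De A : exists c : int, e A = c%:~R * mm A.
  have [n Dn]: exists n : int, e A * mm A = n%:~R.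
    apply: fixed_gal_int => // [|g]; first exact: integralM.
    by rewrite rmorphM /= ge gmm mulrACA -rmorphM /= sg_sqr mul1r.
  have [k Dk]: exists k : int, e A ^+ 2 = k%:~R.
    apply: fixed_gal_int => // [|g]; first exact: integralX.
    by rewrite rmorphXn /= ge exprMn expr2 -rmorphM /= sg_sqr mul1r.
  have Dnk: n ^+ 2 = k * dd A.
    by apply: (@intrL_inj L); rewrite /= rmorphXn rmorphM /= -Dn -Dk -mm_sqr exprMn.
  have /dvdzP[c Dc]: (dd A %| n)%Z.
    rewrite dvdzE absz_dd; apply: prod_distinct_primes_dvdn => // j Aj.
    have: (p j %| `|n| ^ 2)%N.
      rewrite -abszX Dnk abszM dvdn_mull // absz_dd (bigD1 j) //=.
      exact: dvdn_mulr.
    by rewrite Euclid_dvdX // => /andP[].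
  exists c; have nzmm: mm A != 0 by rewrite -sqrf_eq0 mm_sqr intrL_eq0.
  by apply: (mulIf nzmm); rewrite Dn Dc rmorphM /= -mm_sqr expr2 mulrA.
have [c Dc] := fin_all_exists De; exists c.
(* Inversion: after exchanging the sums, [sum_sg] leaves only g = 1, with coefficient 2^s. *)
have Dx: 2 ^+ s * x = \sum_A e A.
  rewrite /e exchange_big (bigD1 1%g) //= -mulr_suml -rmorph_sum /= sum_sg eqxx.
  rewrite big1 => [|g /negPf g1]; last by rewrite -mulr_suml -rmorph_sum /= sum_sg g1 mul0r.
  by rewrite addr0 gal_id rmorphXn.
move=> g; have := congr1 (fun y => g y) Dx; rewrite /= rmorphM rmorphXn /= rmorph_nat => ->.
rewrite rmorph_sum; apply: eq_bigr => A _ /=.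
by rewrite Dc rmorphM /= rmorph_int gmm mulrA rmorphM.
Qed.

(** A nontrivial character sums to 0 by translation. A trivial one would make [mm A] an integer and
    [dd A] a perfect square, although [p j] divides it exactly once. *)
Let sum_gal_sg A : A != set0 -> \sum_(g : gal_of {:L}) sg g A = 0.
Proof.
case/set0Pn=> j Aj; have [h sgh | sg1] := pickP (fun h => sg h A != 1).
  have sghN: sg h A = -1.
    have /eqP: sg h A ^+ 2 = 1 by rewrite expr2 sg_sqr.
    by rewrite sqrf_eq1 (negPf sgh) => /eqP.
  set S := \sum_g _; have: S = - S.
    rewrite {1}/S (reindex_inj (mulIg h)) /= -sumrN; apply: eq_bigr => g _.
    by rewrite sgM sghN mulrN1.
  by move/eqP; rewrite -addr_eq0 -mulr2n mulrn_eq0 => /eqP.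
have [n Dn]: exists n : int, mm A = n%:~R.
  by apply: fixed_gal_int => // g; rewrite gmm; have /negbFE/eqP-> := sg1 g; rewrite mul1r.
have Dn2: n ^+ 2 = dd A by apply: (@intrL_inj L); rewrite /= rmorphXn /= -Dn mm_sqr.
have: (p j %| `|n| ^ 2)%N.
  by rewrite -abszX Dn2 absz_dd (bigD1 j) //=; exact: dvdn_mulr.
rewrite Euclid_dvdX // => /andP[/dvdnP[k Dk] _].
have := congr1 absz Dn2; rewrite abszX Dk absz_dd (bigD1 j) //= expnMn mulnC expnS expn1.
rewrite -mulnA => /eqP; rewrite eqn_pmul2l ?prime_gt0 // => /eqP D.
have: (p j %| \prod_(i in A | i != j) p i)%N by rewrite -D dvdn_mulr.
suffices /negPf->: ~~ (p j %| \prod_(i in A | i != j) p i)%N by [].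
rewrite -prime_coprime //; elim/big_ind: _ => [|a b|i /andP[_ ij]]; first exact: coprimen1.
  by rewrite coprimeMr => -> ->.
by rewrite prime_coprime // dvdn_prime2 // (inj_eq p_inj) eq_sym.
Qed.

(** The signs [sg g A] are summed over all g and A in two ways: by [sum_sg] only g = 1 counts and
    gives 2^s, by [sum_gal_sg] only the empty A counts and gives the order of the group. *)
Lemma card_gal_multiquadratic : #|{: gal_of {:L}}| = (2 ^ s)%N.
Proof.
have: \sum_A \sum_(g : gal_of {:L}) sg g A = (2 ^ s)%N%:Z.
  rewrite exchange_big (bigD1 1%g) //= sum_sg eqxx big1 => [|g /negPf g1].
    by rewrite addr0 -natz natrX.
  by rewrite sum_sg g1.
rewrite (bigD1 set0) //= [X in _ + X]big1 ?addr0; last by move=> A nzA; exact: sum_gal_sg.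
under eq_bigr do rewrite /sg big_set0.
by rewrite sumr_const natz => -[].
Qed.

Lemma moved_onto A : exists g, moved g = A.
Proof.
have [|f _ fK] := inj_card_bij moved_inj; last by exists (f A); rewrite fK.
by rewrite card_gal_multiquadratic -cardsT -powersetT card_powerset cardsT card_ord.
Qed.

Let half j : L := (1 + m j) / 2.

Let two_neq0 : (2 : L) != 0.
Proof. exact: (etrans (congr1 negb (intrL_eq0 L 2%:Z))). Qed.

Let halfE j : m j = half j *+ 2 - 1.
Proof. by rewrite -[_ *+ 2]mulr_natr /half divfK // addrAC subrr add0r. Qed.

(** With 1 - [qstar (p j)] = 4 k, [half j] is a root of X (X - 1) + k. *)
Lemma integral_half j : integral (half j).
Proof.
have [k Dk] := qstar_mod4 (odd_p j).
exists ('X * ('X - 1%:P) + k%:P); split.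
  rewrite monicE lead_coefDl ?lead_coefM ?lead_coefX ?lead_coefXsubC ?mulr1 //.
  by rewrite mulrC size_mulX ?polyXsubC_eq0 // size_XsubC (leq_ltn_trans (size_polyC_leq1 _)).
rewrite rmorphD rmorphM rmorphB /= map_polyX !map_polyC /= /root !hornerE.
have: 4 * (half j * (half j - 1) + k%:~R) = 0.
  have := congr1 (fun z : int => z%:~R : L) Dk; rewrite /= rmorphB /= -m_sqr rmorphM /=.
  by rewrite /half => Dk'; rewrite mulrDr -Dk'; field.
move/eqP; rewrite mulf_eq0 => /orP[] //.
by rewrite (intrL_eq0 L 4%:Z).
Qed.

Let gal_half g j : g (half j) = if j \in moved g then 1 - half j else half j.
Proof.
rewrite /half rmorphM rmorphD fmorphV rmorph1 rmorph_nat /= gm /eps.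
by case: ifP => _; rewrite ?mulN1r ?mul1r //; field.
Qed.

(** * Inertia at an arbitrary prime; unramified primes *)

Section InertiaAwayFrom.
Variables (P : L -> Prop) (q : nat).
Hypotheses (pr_q : prime q) (Pq : lies_over P q).

(** If g moves [m j], then g sends [half j] to 1 - [half j]; the difference is - m j, so P contains
    [p j]. With [m j] in place of [half j] the difference would be - 2 m j, which says nothing for q
    = 2. *)
Lemma inertia_moved g j : inertia_mem P g -> j \in moved g -> q = p j.
Proof.
case=> _ /(_ _ (integral_half j)); rewrite gal_half => Pg Mj; rewrite Mj in Pg.
have: P (m j ^+ 2).
  rewrite -sqrrN expr2; apply: (ideal_mull Pq).
    rewrite -mulN1r; apply: integralM; first exact: (integral_intr _ (-1)).
    exact: integral_sqrt.
  by congr P: Pg; rewrite [in RHS]halfE; ring.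
by rewrite m_sqr (ideal_intr pr_q Pq) dvdz_qstar dvdn_prime2 // => /eqP.
Qed.

End InertiaAwayFrom.

(* The [bt B] are the conjugates of [prod_j (1 + m j) / 2], and [W B] is
   [dd setT] times the element dual to [bt B] for the trace form, so that
   [dd setT * x] is the sum of the [Tr (x * bt B) * W B].  Unlike the expansion
   in the [mm A], which costs a power of [2], this also works for [q = 2]. *)
Lemma unramified_away (q : nat) : prime q -> (forall j, q != p j) -> ~ ramified L q.
Proof.
move=> pr_q q'p [x [n [ix Nx [y [iy Dxn]]]]].
have [P Pq] := prime_over_exists L pr_q.
(* Being nilpotent mod q, x lies in P together with all its conjugates. *)
have Pgx g : P (g x).
  apply: (ideal_pow Pq (n := n)); first exact: integral_gal.
  rewrite -rmorphXn /= Dxn rmorphM rmorph_nat /=.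
  exact: (ideal_mulr Pq (integral_gal g iy) (proj2 Pq)).
pose bt (B : {set 'I_s}) := \prod_j (if j \in B then half j else 1 - half j).
pose W (B : {set 'I_s}) :=
  \prod_j (if j \in B then m j * half j else - (m j * (1 - half j))).
have ih1 j : integral (1 - half j).
  by apply: integralB; [exact: (integral_intr _ 1) | exact: integral_half].
have ibt B : integral (bt B).
  by apply: integral_bigprod => j _; case: ifP => _ //; exact: integral_half.
have iW B : integral (W B).
  apply: integral_bigprod => j _; case: ifP => _; last rewrite -mulN1r.
    by apply: integralM; [exact: integral_sqrt | exact: integral_half].
  apply: integralM; first exact: (integral_intr _ (-1)).
  by apply: integralM => //; exact: integral_sqrt.
(* The sum over B is a product over j. For g = 1 its factors are the squares of the [m j]; if g
   moves [m j], the factor at j is 0. *)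
have key g : \sum_B g (bt B) * W B = if g == 1%g then (dd setT)%:~R else 0.
  have ->: \sum_B g (bt B) * W B =
    \prod_j (g (half j) * (m j * half j) + g (1 - half j) * - (m j * (1 - half j))).
    rewrite bigA_distr; apply: eq_big => // B _; rewrite /bt rmorph_prod -big_split /=.
    by apply: eq_bigr => j _; case: ifP.
  have [-> | ntg] := eqVneq g 1%g.
    rewrite /dd rmorph_prod /=; apply: eq_big => [j | j _]; first by rewrite in_setT.
    by rewrite -m_sqr !gal_id [m j]halfE; ring.
  have [j Mj]: exists j, j \in moved g.
    by apply/set0Pn; apply: contraNneq ntg => /moved_eq0 ->.
  rewrite (bigD1 j) //= [X in X * _](_ : _ = 0) ?mul0r //.
  by rewrite rmorphB rmorph1 /= gal_half Mj; ring.
have Dt B : exists k : int, \sum_(g : gal_of {:L}) g (x * bt B) = q%:R * k%:~R.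
  have [t Dt]: exists t : int, \sum_(g : gal_of {:L}) g (x * bt B) = t%:~R.
    apply: fixed_gal_int => // [|h].
      by apply: integral_bigsum => g _; apply: integral_gal; exact: integralM.
    rewrite rmorph_sum [RHS](reindex_inj (mulIg h)) /=.
    by apply: eq_bigr => g _; rewrite galMx.
  have /(ideal_intr pr_q Pq)/dvdzP[k Dk]: P t%:~R.
    rewrite -Dt; apply: (ideal_bigsum Pq) => g _; rewrite rmorphM /=.
    by apply: (ideal_mulr Pq) => //; exact: integral_gal.
  by exists k; rewrite Dt Dk rmorphM mulrC.
have [k Dk] := fin_all_exists Dt.
pose Y := \sum_B (k B)%:~R * W B.
have iY : integral Y.
  by apply: integral_bigsum => B _; apply: integralM => //; exact: integral_intr.
have DY: (dd setT)%:~R * x = q%:R * Y.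
  rewrite /Y mulr_sumr; under [RHS]eq_bigr do rewrite mulrA -Dk mulr_suml.
  rewrite exchange_big (bigD1 1%g) //= [X in _ = _ + X]big1 => [|g /negPf ntg].
    rewrite addr0; under [RHS]eq_bigr do rewrite rmorphM -mulrA.
    by rewrite -mulr_sumr /= key eqxx gal_id mulrC.
  under eq_bigr do rewrite rmorphM -mulrA.
  by rewrite -mulr_sumr /= key ntg mulr0.
(* As q is prime to [dd setT], Bezout turns the divisibility of dd setT * x by q into that of x,
   which was excluded. *)
have: coprimez q%:Z (dd setT).
  rewrite coprimezE /= absz_dd; elim/big_ind: _ => [|a b|j _]; first exact: coprimen1.
    by rewrite coprimeMr => -> ->.
  by rewrite prime_coprime // dvdn_prime2.
case/coprimezP=> -[u v] /= Duv; case: Nx; exists (u%:~R * x + v%:~R * Y); split.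
  by apply: integralD; apply: integralM => //; exact: integral_intr.
rewrite mulrDr [q%:R * (v%:~R * Y)]mulrCA -DY.
have {1}->: x = (u * q%:Z + v * dd setT)%:~R * x by rewrite Duv mul1r.
by rewrite rmorphD !rmorphM /=; ring.
Qed.

Lemma ramified_at i : ramified L (p i).
Proof.
apply: (ramified_sqrt (m_sqr i)); rewrite ?dvdz_qstar //; last by rewrite -lt0n prime_gt0.
by rewrite -[X in (_ %| X)%N]muln1 dvdn_pmul2l ?prime_gt0 // dvdn1 gtn_eqF // prime_gt1.
Qed.

Definition nonresidues (i : 'I_s) : {set 'I_s} :=
  [set j | (j != i) && (legendre (p i) (p j) == -1)].

(** * Inertia and decomposition groups at p i *)

Section AtPrime.
Variables (i : 'I_s) (P : L -> Prop).
Hypothesis Pi : lies_over P (p i).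

Let chi (k : int) : int := qchar (k%:~R : 'F_(p i)).

Let chiM k l : chi (k * l) = chi k * chi l.
Proof. by rewrite /chi rmorphM qcharM. Qed.

Let chi_qstar j : j != i -> chi (qstar (p j)) = legendre (p i) (p j).
Proof. by move=> ij; rewrite /chi qchar_qstar // (inj_eq p_inj) eq_sym. Qed.

Let chi_qstarE j : j != i -> chi (qstar (p j)) = (-1) ^+ (j \in nonresidues i).
Proof.
move=> ij; rewrite inE ij -chi_qstar //=; have: (qstar (p j))%:~R != 0 :> 'F_(p i).
  by rewrite Fp_intr_eq0 // dvdz_qstar dvdn_prime2 // (inj_eq p_inj) eq_sym.
by rewrite /chi => /qchar_neq0[] ->.
Qed.

Let chi_dd A : i \notin A -> chi (dd A) = \prod_(j in A) (-1) ^+ (j \in nonresidues i).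
Proof.
move=> A'i; rewrite /dd (big_morph chi chiM (_ : chi 1 = 1)); last exact: qchar1.
by apply: eq_bigr => j Aj; rewrite chi_qstarE //; apply: contraNneq A'i => <-.
Qed.

Let Pmm A : i \in A -> P (mm A).
Proof.
move=> Ai; rewrite /mm (bigD1 i) //=; apply: (ideal_mulr Pi).
  by apply: integral_bigprod => j _; exact: integral_sqrt.
apply: (ideal_sqr Pi); first exact: integral_sqrt.
by rewrite m_sqr (ideal_intr (pr_p i) Pi) dvdz_qstar.
Qed.

Let P_cancel (k : int) x : ~~ ((p i)%:Z %| k)%Z -> integral x -> P (k%:~R * x) -> P x.
Proof.
move=> Nk ix /(ideal_prime Pi)[] //; first exact: integral_intr.
by move/(ideal_intr (pr_p i) Pi) => pk; rewrite pk in Nk.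
Qed.

Let p_2s : ~~ ((p i)%:Z %| 2 ^+ s)%Z.
Proof.
rewrite dvdzE abszX /= Euclid_dvdX // dvdn_prime2 //.
by apply/negP => /andP[/eqP p2 _]; have := odd_p i; rewrite p2.
Qed.

Let decomp_of_sub g : (forall x, P x -> P (g x)) -> decomp_mem P g.
Proof. by move=> Pg x; split; [rewrite -{2}[x](gal_involutive g) | ]; exact: Pg. Qed.

(** For the converse, 2^s (g x - x) is expanded: the terms with i in A lie in P because [m i] does,
    and g fixes the other products. The factor 2^s cancels because [p i] is odd. *)
Lemma inertia_memE g : inertia_mem P g <-> moved g \subset [set i].
Proof.
split=> [Ig | /subsetP Mg].
  by apply/subsetP=> j /(inertia_moved (pr_p i) Pi Ig) /p_inj ->; rewrite inE.
have Pgx x : integral x -> P (g x - x).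
  move=> ix; apply: (P_cancel p_2s).
    by apply: integralB => //; exact: integral_gal.
  have [c Dc] := expand ix; have := Dc 1%g; rewrite gal_id => Dx.
  rewrite rmorphXn /= mulrBr Dc Dx -sumrB; apply: (ideal_bigsum Pi) => A _.
  rewrite -mulrBl -rmorphB /=; have [Ai | A'i] := boolP (i \in A).
    by apply: (ideal_mull Pi); [exact: integral_intr | exact: Pmm].
  have sg1 h : moved h \subset [set i] -> sg h A = 1.
    move=> /subsetP Mh; rewrite /sg big1 // => j Aj; rewrite /eps.
    case: (boolP (j \in _)) => // /Mh; rewrite inE => /eqP ji.
    by rewrite -ji Aj in A'i.
  rewrite !sg1 ?subrr ?mul0r; [exact: (ideal0 Pi) | | exact/subsetP].
  by apply/subsetP=> j; rewrite inE gal_id eqxx.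
split=> //; apply: decomp_of_sub => x Px.
rewrite -[g x](subrK x); apply: (idealD Pi) => //.
by apply: Pgx; exact: (ideal_integral Pi).
Qed.

(** Here [mm A] is congruent to an integer a mod P. If g negated it, P would contain mm A - a and -
    mm A - a, hence [mm A] and [dd A], against chi (dd A) = 1. *)
Let decomp_fix g A : decomp_mem P g -> i \notin A -> chi (dd A) = 1 -> sg g A = 1.
Proof.
move=> Dg A'i chiA.
have [a Pa] := ideal_sqrt_mod (pr_p i) Pi (integral_mm A) (mm_sqr A) chiA.
have: sg g A = 1 \/ sg g A = -1.
  have /eqP: sg g A ^+ 2 = 1 by rewrite expr2 sg_sqr.
  by rewrite sqrf_eq1 => /orP[] /eqP; [left | right].
case=> // sgA; have := (Dg (mm A - a%:~R)).2 Pa.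
rewrite rmorphB /= gmm sgA rmorph_int mulN1r => Pb.
have Pmm': P (mm A).
  apply: (ideal_two (pr_p i) Pi (odd_p i)) => //.
  by congr P: (idealB Pi Pa Pb); ring.
have: P (mm A ^+ 2) by rewrite expr2; exact: (ideal_mull Pi).
rewrite mm_sqr => /(ideal_intr (pr_p i) Pi).
rewrite -Fp_intr_eq0 //; move: chiA; rewrite /chi /qchar.
by case: ifP.
Qed.

Lemma decomp_memE g :
  decomp_mem P g <-> moved g :\ i = set0 \/ moved g :\ i = nonresidues i.
Proof.
have sg_set1 j : sg g [set j] = (-1) ^+ (j \in moved g) by rewrite /sg big_set1.
have dd_set1 j : dd [set j] = qstar (p j) by rewrite /dd big_set1.
split=> [Dg | Mg].
  (* [decomp_fix] on singletons: g fixes [m j] whenever [qstar (p j)] is a residue. *)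
  have sub: moved g :\ i \subset nonresidues i.
    apply/subsetP=> j; rewrite !inE => /andP[ij]; rewrite ij /=.
    apply: contraR => Nj; have := @decomp_fix g [set j] Dg.
    rewrite in_set1 eq_sym ij dd_set1 chi_qstarE // inE ij (negPf Nj) sg_set1.
    by move=> /(_ isT erefl); rewrite inE; case: (_ == _).
  have [M0 | [j Mj]] := set_0Vmem (moved g :\ i); [by left | right].
  apply/eqP; rewrite eqEsubset sub; apply/subsetP=> k Rk.
  have ki: k != i by move: Rk; rewrite inE => /andP[].
  rewrite in_setD1 ki /=; have [<- | jk] := eqVneq j k; first by case/setD1P: Mj.
  have Rj := subsetP sub j Mj; case/setD1P: Mj => ji Mj.
  (* A product of two nonresidues is a residue, so g fixes m j * m k and moves both factors or
     neither. *)
  have := @decomp_fix g [set j; k] Dg.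
  rewrite in_set2 !(eq_sym i) (negPf ji) (negPf ki) chi_dd; last first.
    by rewrite in_set2 !(eq_sym i) negb_or ji.
  rewrite /sg !big_setU1 ?in_set1 // !big_set1 Rj Rk /eps Mj => /(_ isT erefl).
  by case: (k \in _).
have [Mi | [j0 Mj0]] := set_0Vmem (moved g :\ i).
  have []: inertia_mem P g by apply/inertia_memE; rewrite -setD_eq0 Mi.
  by [].
have DM: moved g :\ i = nonresidues i.
  by case: Mg => // M0; rewrite M0 inE in Mj0.
have epsE' j : j != i -> eps g j = chi (qstar (p j)).
  by move=> ji; rewrite chi_qstarE // -DM in_setD1 ji.
have sgE A : i \notin A -> sg g A = chi (dd A).
  move=> A'i; rewrite chi_dd //; apply: eq_bigr => j Aj.
  have ji: j != i by apply: contraNneq A'i => <-.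
  by rewrite epsE' // chi_qstarE.
have j0i: j0 != i by case/setD1P: Mj0.
have Rj0: j0 \in nonresidues i by rewrite -DM.
set d0 := qstar (p j0); pose m0 := m j0.
have m02: m0 ^+ 2 = d0%:~R by exact: m_sqr.
have chi0: chi d0 = -1 by rewrite chi_qstarE // Rj0.
have Nd0: ~~ ((p i)%:Z %| d0)%Z.
  by rewrite dvdz_qstar dvdn_prime2 // (inj_eq p_inj) eq_sym.
(* Modulo [P] each [d0 * mm A] is [a + b * m0] with integers [a] and [b], and [g]
   acts by [m0 |-> - m0]; as [d0] is a nonresidue, [a + b * m0] lies in [P] only
   if [p i] divides [a] and [b]. *)
have appr A : exists ab : int * int,
    P (d0%:~R * mm A - (ab.1%:~R + ab.2%:~R * m0)) /\
    P (d0%:~R * ((sg g A)%:~R * mm A) - (ab.1%:~R - ab.2%:~R * m0)).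
  have [Ai | A'i] := boolP (i \in A).
    exists (0, 0); rewrite /= mul0r addr0 !subr0; split.
      by apply: (ideal_mull Pi); [exact: integral_intr | exact: Pmm].
    apply: (ideal_mull Pi); first exact: integral_intr.
    by apply: (ideal_mull Pi); [exact: integral_intr | exact: Pmm].
  have ndA: (dd A)%:~R != 0 :> 'F_(p i).
    rewrite -(qchar_eq0 (dd A)%:~R) -/(chi _) chi_dd //.
    by apply/prodf_neq0 => j _; rewrite signr_eq0.
  rewrite sgE //; case: (qchar_neq0 ndA) => chiA; rewrite /chi chiA.
    have [a Pa] := ideal_sqrt_mod (pr_p i) Pi (integral_mm A) (mm_sqr A) chiA.
    exists (d0 * a, 0); rewrite /= mul0r addr0 subr0 mul1r (intrM _ d0 a) -mulrBr.
    by split; apply: (ideal_mull Pi) => //; exact: integral_intr.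
  (* Now mm A * m0 is congruent to an integer b, so d0 * mm A = m0 * (mm A * m0) is congruent to b *
     m0; the factor d0 avoids inverting m0. *)
  have [|||b Pb] := @ideal_sqrt_mod L P (p i) (mm A * m0) (dd A * d0) (pr_p i) Pi.
  - by apply: integralM => //; exact: integral_sqrt.
  - by rewrite exprMn mm_sqr m02 (intrM _ (dd A) d0).
  - by rewrite -/(chi _) chiM chi0 /chi chiA.
  exists (0, b) => /=; rewrite add0r sub0r -m02 mulrNz mulN1r.
  have Pc: P (m0 ^+ 2 * mm A - b%:~R * m0).
    have ->: m0 ^+ 2 * mm A - b%:~R * m0 = m0 * (mm A * m0 - b%:~R) by ring.
    by apply: (ideal_mull Pi) => //; exact: integral_sqrt.
  by split=> //; congr P: (idealN Pi Pc); ring.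
have [ab Dab] := fin_all_exists appr.
apply: decomp_of_sub => x Px; have ix := ideal_integral Pi Px.
have [c Dc] := expand ix.
pose u : int := \sum_A c A * (ab A).1; pose v : int := \sum_A c A * (ab A).2.
have uvE (e : int) : u%:~R + e%:~R * (v%:~R * m0) =
    \sum_A (c A)%:~R * ((ab A).1%:~R + e%:~R * ((ab A).2%:~R * m0)).
  rewrite /u /v !rmorph_sum /= mulr_suml mulr_sumr -big_split /=.
  by apply: eq_bigr => A _; rewrite !rmorphM /=; ring.
have P1: P (d0%:~R * (2 ^+ s * x) - (u%:~R + v%:~R * m0)).
  have := Dc 1%g; rewrite gal_id => ->; have := uvE 1; rewrite mul1r => ->.
  rewrite mulr_sumr -sumrB; apply: (ideal_bigsum Pi) => A _.
  have ->: sg 1%g A = 1 by rewrite /sg big1 // => j _; rewrite /eps inE gal_id eqxx.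
  rewrite mulr1 mul1r mulrCA -mulrBr; apply: (ideal_mull Pi); first exact: integral_intr.
  by case: (Dab A).
have Pg: P (d0%:~R * (2 ^+ s * g x) - (u%:~R - v%:~R * m0)).
  rewrite Dc; have := uvE (-1); rewrite mulrNz mulN1r => ->.
  rewrite mulr_sumr -sumrB; apply: (ideal_bigsum Pi) => A _.
  rewrite mulN1r (intrM _ (c A) (sg g A)) -[X in d0%:~R * X]mulrA.
  rewrite [d0%:~R * _]mulrCA -mulrBr; apply: (ideal_mull Pi); first exact: integral_intr.
  by case: (Dab A).
have i2s y : integral y -> integral (2 ^+ s * y).
  by move=> iy; apply: integralM => //; apply: integralX; exact: (integral_intr _ 2).
have Puv: P (u%:~R + v%:~R * m0).
  have P2: P (d0%:~R * (2 ^+ s * x)).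
    apply: (ideal_mull Pi); first exact: integral_intr.
    by apply: (ideal_mull Pi) => //; apply: integralX; exact: (integral_intr _ 2).
  by congr P: (idealB Pi P2 P1); ring.
(* Multiplication by u - v m0 gives the norm u^2 - v^2 d0; were v prime to [p i], d0 would be a
   square mod [p i]. *)
have Duv: ((p i)%:Z %| u ^+ 2 - v ^+ 2 * d0)%Z.
  apply/(ideal_intr (pr_p i) Pi).
  have ->: (u ^+ 2 - v ^+ 2 * d0)%:~R = (u%:~R - v%:~R * m0) * (u%:~R + v%:~R * m0).
    by rewrite rmorphB /= (intrM _ (v ^+ 2) d0) !rmorphXn /= -m02; ring.
  apply: (ideal_mull Pi) => //; apply: integralB; first exact: integral_intr.
  by apply: integralM; [exact: integral_intr | exact: integral_sqrt].
have pv: ((p i)%:Z %| v)%Z.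
  apply: contraT => Npv; have: chi (v ^+ 2 * d0) = 1.
    have v0: v%:~R != 0 :> 'F_(p i) by rewrite Fp_intr_eq0.
    apply/eqP/qchar1P; split.
      by rewrite rmorphM rmorphXn /= mulf_neq0 ?expf_neq0 // Fp_intr_eq0.
    exists u%:~R; apply/eqP; rewrite -subr_eq0 -rmorphXn -rmorphB /=.
    by rewrite Fp_intr_eq0.
  rewrite chiM chi0 expr2 chiM -expr2 qchar_sqr ?mul1r //.
  by rewrite Fp_intr_eq0.
have pu: ((p i)%:Z %| u)%Z.
  have: ((p i)%:Z %| u ^+ 2)%Z.
    by rewrite -[u ^+ 2](subrK (v ^+ 2 * d0)) rpredD // expr2 -mulrA dvdz_mulr.
  by rewrite 2!dvdzE abszX /= Euclid_dvdX // => /andP[].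
apply: (P_cancel p_2s); first exact: integral_gal.
rewrite rmorphXn /=; apply: (P_cancel Nd0); first by apply: i2s; exact: integral_gal.
rewrite -[X in P X](subrK (u%:~R - v%:~R * m0)); apply: (idealD Pi) => //.
apply: (idealB Pi); first exact/(ideal_intr (pr_p i) Pi).
by apply: (ideal_mulr Pi); [exact: integral_sqrt | exact/(ideal_intr (pr_p i) Pi)].
Qed.

End AtPrime.

(** The inertia group at q has at most two elements if q is some [p i], which is odd, and is trivial
    otherwise; either way its order is less than q. *)
Lemma tame_multiquadratic : tamely_ramified L.
Proof.
move=> q P pr_q Pq; exists [set g | moved g \subset [set j | p j == q]]; split.
  move=> g; rewrite inE; split=> [Mg | [_ Ig]]; last first.
    by apply/subsetP=> j /(inertia_moved pr_q Pq Ig) ->; rewrite inE.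
  split; first exact: mem_Gal1.
  have [i /eqP Dq | noq] := pickP (fun j => p j == q).
    move: Pq; rewrite -Dq => Pi; apply/(inertia_memE Pi).
    by apply: subset_trans Mg _; apply/subsetP=> j; rewrite !inE -Dq (inj_eq p_inj).
  have ->: g = 1%g.
    apply: moved_eq0; apply/eqP; rewrite -subset0; apply: subset_trans Mg _.
    by apply/subsetP=> j; rewrite !inE noq.
  split=> [x | x _]; rewrite gal_id ?subrr //; exact: (ideal0 Pq).
set I := [set _ | _].
have I1: 1%g \in I by rewrite inE; apply/subsetP=> j; rewrite inE gal_id eqxx.
have leI: (#|I| <= 2 ^ #|[set j | p j == q]|)%N.
  rewrite -card_powerset -(card_imset _ moved_inj); apply: subset_leq_card.
  by apply/subsetP=> B /imsetP[g]; rewrite inE => Mg ->; rewrite inE.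
have I_gt0: (0 < #|I|)%N by apply/card_gt0P; exists 1%g.
have [i /eqP Dq | noq] := pickP (fun j => p j == q).
  rewrite gtnNdvd // (leq_ltn_trans leI) //.
  have ->: [set j | p j == q] = [set i].
    by apply/setP=> j; rewrite !inE -Dq (inj_eq p_inj).
  by rewrite cards1 -Dq odd_prime_gt2.
rewrite gtnNdvd // (leq_ltn_trans leI) //.
have ->: [set j | p j == q] = set0 by apply/setP=> j; rewrite !inE noq.
by rewrite cards0 prime_gt1.
Qed.

End MultiQuadratic.

(** * Tame configurations *)

Section Configuration.
Local Open Scope group_scope.
Variables (s : nat) (gT : finGroupType) (G : {group gT}) (T Z : 'I_s -> {group gT}).

(** Under G = T_1 x ... x T_s this is the set of nontrivial coordinates of h, the counterpart of
    [moved] on the Galois side. *)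
Definition supp (h : gT) : {set 'I_s} := [set j | h \notin prod_except T j].

Hypothesis cfg : tame_config G T Z.

Let abelG : 2.-abelem G. Proof. by case: cfg. Qed.
Let cGG : abelian G. Proof. exact: abelem_abelian abelG. Qed.
Let oG : #|G| = (2 ^ s)%N. Proof. by case: cfg. Qed.
Let genG : <<\bigcup_(i < s) T i>> = G. Proof. by case: cfg. Qed.
Let sTZ i : T i \subset Z i. Proof. by case: cfg => _ _ _ /(_ i)[]. Qed.
Let sZG i : Z i \subset G. Proof. by case: cfg => _ _ _ /(_ i)[]. Qed.
Let cycZT i : cyclic (Z i / T i). Proof. by case: cfg => _ _ _ /(_ i)[]. Qed.
Let sTG i : T i \subset G. Proof. exact: subset_trans (sTZ i) (sZG i). Qed.

Let sqG h : h \in G -> h * h = 1.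
Proof. by case/abelemP: abelG => // _ e2 /e2; rewrite expgS expg1. Qed.

Let comG g h : g \in G -> h \in G -> g * h = h * g.
Proof. by move=> Gg Gh; exact: (centsP cGG). Qed.

Let cycle_pair h : h \in G -> <[h]> = [set 1; h].
Proof.
move=> Gh; have [-> | nth] := eqVneq h 1; first by rewrite cycle1 setUid.
have oh: #[h] = 2 := abelem_order_p abelG Gh nth.
apply/esym/eqP; rewrite eqEcard subUset !sub1set group1 cycle_id /=.
by rewrite -orderE oh cards2 eq_sym nth.
Qed.

Let x i : gT := odflt 1 [pick h | T i == <[h]> :> {set gT}].

Let Tx i : T i = <[x i]> :> {set gT}.
Proof.
rewrite /x; case: pickP => [h /eqP // | noh].
by case: cfg => _ _ _ /(_ i)[/cyclicP[h Dh] _ _ _]; have := noh h; rewrite Dh eqxx.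
Qed.

Let Gx i : x i \in G.
Proof. by rewrite (subsetP (sTG i)) // Tx cycle_id. Qed.

Let card_gen (r : seq 'I_s) : (#|<<\bigcup_(j <- r) T j>>| <= 2 ^ size r)%N.
Proof.
elim: r => [|i r IHr]; first by rewrite big_nil gen0 cards1.
have sUG: <<\bigcup_(j <- r) T j>> \subset G.
  by rewrite gen_subG; elim/big_ind: _ => // [|A B sA sB]; rewrite ?sub0set // subUset sA.
rewrite big_cons -joingE -joing_idr norm_joinEr; last first.
  by rewrite cents_norm // (sub_abelian_cent2 cGG).
have le2: (#|T i| <= 2)%N by rewrite Tx cycle_pair // cards2; case: (_ != _).
apply: leq_trans (_ : (#|T i| * #|<<\bigcup_(j <- r) T j>>| <= _)%N); last by rewrite expnS leq_mul.
by rewrite mul_cardG leq_pmulr ?cardG_gt0.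

Qed.

(** [prod_except T i] has index 2 and misses [x i]: otherwise s - 1 groups of order at most 2 would
    generate G, which has order 2^s. *)
Let prod_exceptE i : exists K : {group gT},
  [/\ prod_except T i = K, K \subset G, x i \notin K &
      forall h, h \in G -> h \in K \/ h * x i \in K].
Proof.
exists <<\bigcup_(k < s | k != i) T k>>%G; split=> //.
- by rewrite gen_subG; apply/bigcupsP => k _; exact: sTG.
- apply/negP => Kx; have: (#|G| <= #|prod_except T i|)%N.
    rewrite subset_leq_card // -genG gen_subG; apply/bigcupsP => k _.
    have [-> | ki] := eqVneq k i; first by rewrite Tx cycle_subG.
    by apply: sub_gen; exact: (bigcup_sup k).
  rewrite leqNgt oG /prod_except; case/negP.
  have ->: \bigcup_(k < s | k != i) T k = \bigcup_(k <- enum (predC1 i)) T k.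
    by rewrite big_enum.
  apply: leq_ltn_trans (card_gen _) _; rewrite ltn_exp2l // -cardE.
  by rewrite (cardC1 i) card_ord ltn_predL (leq_ltn_trans _ (ltn_ord i)).
move=> h Gh; set K := <<_>>%G.
have sKG: K \subset G by rewrite gen_subG; apply/bigcupsP => k _; exact: sTG.
have: h \in K * T i.
  have nKT: T i \subset 'N(K).
    by rewrite cents_norm // (sub_abelian_cent2 cGG).
  rewrite -norm_joinEr //; apply: subsetP h Gh; rewrite -genG gen_subG.
  apply/bigcupsP => k _; have [-> | ki] := eqVneq k i; first exact: joing_subr.
  apply: subset_trans (joing_subl _ _); apply: sub_gen; exact: (bigcup_sup k).
case/mulsgP=> k t Kk; rewrite Tx cycle_pair // !inE => /orP[] /eqP-> ->.
  by left; rewrite mulg1.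
by right; rewrite -mulgA sqG // mulg1.
Qed.

Lemma suppM g h : g \in G -> h \in G ->
  supp (g * h) = [set j | (j \in supp g) (+) (j \in supp h)].
Proof.
move=> Gg Gh; apply/setP=> j; rewrite !inE.
have [K [-> sKG K'x defG]] := prod_exceptE j.
have [Kg | K'g] := boolP (g \in K); first by rewrite groupMl.
have [Kh | K'h] := boolP (h \in K); first by rewrite groupMr // K'g.
have [Kg | Kgx] := defG g Gg; first by rewrite Kg in K'g.
have [Kh | Khx] := defG h Gh; first by rewrite Kh in K'h.
rewrite /=; have := groupM Kgx Khx.
rewrite (comG Gh) // mulgA -[g * x j * x j]mulgA sqG // mulg1.
by move=> ->.
Qed.

Lemma supp1 : supp 1 = set0.
Proof.
by apply/setP=> j; rewrite !inE; have [K [-> _ _ _]] := prod_exceptE j; rewrite group1.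
Qed.

Let suppx i : supp (x i) = [set i].
Proof.
apply/setP=> j; rewrite !inE; have [-> | ji] := eqVneq j i.
  by have [K [-> _ ->]] := prod_exceptE i.
apply/negbTE; rewrite negbK mem_gen //; apply/bigcupP; exists i; first by rewrite eq_sym.
by rewrite Tx cycle_id.
Qed.

Lemma supp_onto A : exists2 h, h \in G & supp h = A.
Proof.
have [n leAn] := ubnP #|A|; elim: n => // n IHn in A leAn *.
have [-> | [a Aa]] := set_0Vmem A; first by exists 1; rewrite ?group1 ?supp1.
have [|h Gh Dh] := IHn (A :\ a); first by rewrite (cardsD1 a) Aa in leAn.
exists (x a * h); first by rewrite groupM.
rewrite suppM // Dh suppx; apply/setP=> j; rewrite !inE.
by have [-> | ja] := eqVneq j a; rewrite ?Aa.
Qed.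

Lemma supp_inj : {in G &, injective supp}.
Proof.
have im: [set supp h | h in G] = setT.
  by apply/setP=> A; rewrite inE; have [h Gh <-] := supp_onto A; rewrite imset_f.
apply/imset_injP; rewrite im oG -powersetT card_powerset cardsT card_ord.
by [].
Qed.

Lemma mem_inertia i h : h \in G -> (h \in T i) = (supp h \subset [set i]).
Proof.
move=> Gh; rewrite Tx cycle_pair // !inE subset1 -suppx -supp1 [RHS]orbC.
by rewrite !(inj_in_eq supp_inj) ?group1.
Qed.

(** The intersection of [Z i] with [prod_except T i] meets [T i] trivially, so it embeds in the
    cyclic group [Z i / T i]; hence the [pick] in [zgen] succeeds and its default value never
    occurs. *)
Let zgenP i : [/\ zgen T Z i \in G, zgen T Z i \in prod_except T i &
  forall h, h \in Z i -> h \in prod_except T i -> (h == 1) || (h == zgen T Z i)] /\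
  zgen T Z i \in Z i.
Proof.
have [K [DK sKG K'x defG]] := prod_exceptE i; rewrite /zgen DK.
have nTZ: Z i \subset 'N(T i) by rewrite cents_norm // (sub_abelian_cent2 cGG).
have cycC: cyclic (Z i :&: K).
  have sCZ := subsetIl (Z i) K.
  have iso: (Z i :&: K)%G \isog ((Z i :&: K)%G / T i).
    apply: quotient_isog; first exact: subset_trans nTZ.
    apply/eqP; rewrite -subG1; apply/subsetP=> h; rewrite 2!inE => /and3P[Th _ Kh].
    move: Th; rewrite Tx cycle_pair // !inE => /orP[] // /eqP Dh.
    by rewrite Dh (negPf K'x) in Kh.
  by rewrite (isog_cyclic iso); apply: cyclicS (cycZT i); exact: quotientS.
case: pickP => [z /andP[/setIP[Zz Kz] /eqP Dz] | noz]; last first.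
  case/cyclicP: cycC => z Dz; have := noz z; rewrite Dz eqxx andbT.
  by rewrite cycle_id.
have Gz: z \in G := subsetP sKG z Kz.
split=> //; split=> // h Zh Kh; have: h \in Z i :&: K by rewrite inE Zh.
by rewrite -Dz cycle_pair // !inE.
Qed.

Lemma supp_zgen_notin i : i \notin supp (zgen T Z i).
Proof. by have [[_ Kz _] _] := zgenP i; rewrite inE negbK. Qed.

(** Multiplying h by the generator of [T i], which lies in [Z i], erases the coordinate i; the
    result lies in [prod_except T i], where [Z i] is reduced to 1 and [zgen T Z i]. *)
Lemma mem_decomp i h : h \in G ->
  (h \in Z i) = (supp h :\ i == set0) || (supp h :\ i == supp (zgen T Z i)).
Proof.
move=> Gh; have [[Gz Kz Cz] Zz] := zgenP i.
have Zx: x i \in Z i by rewrite (subsetP (sTZ i)) // Tx cycle_id.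
have [h' [Gh' Dh' Zh']]: exists h',
    [/\ h' \in G, supp h' = supp h :\ i & (h' \in Z i) = (h \in Z i)].
  have [hi | h'i] := boolP (i \in supp h).
    exists (h * x i); split; [by rewrite groupM | | by rewrite groupMr].
    rewrite suppM // suppx; apply/setP=> j; rewrite [LHS]in_set in_setD1 in_set1.
    by have [-> | ji] := eqVneq j i; rewrite ?hi ?addbF.
  exists h; split=> //; apply/setP=> j; rewrite in_setD1.
  by have [-> | //] := eqVneq j i; rewrite (negPf h'i).
have Kh': h' \in prod_except T i.
  have: i \notin supp h' by rewrite Dh' setD11.
  by rewrite inE negbK.
rewrite -Zh' -Dh' -supp1 !(inj_in_eq supp_inj) ?group1 //.
apply/idP/idP => [Zh1 | /orP[] /eqP-> //]; first exact: Cz.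
Qed.

Lemma sign_matrixE i j :
  sign_matrix T Z i j = (if i == j then 0 else (-1) ^+ (j \in supp (zgen T Z i)))%R.
Proof. by rewrite /sign_matrix inE; case: (i == j) => //; case: (_ \in _). Qed.

End Configuration.

(** * Existence of multiquadratic fields and square roots of characters *)

Lemma pchar_number_field (L : fieldExtType rat) : [pchar L] =i pred0.
Proof.
apply/pcharf0P => n; rewrite -scaler_nat -[_ *: _]/(in_alg L _) fmorph_eq0.
by rewrite pnatr_eq0.
Qed.

Lemma gal_generators_sep (L : splittingFieldType rat) (rs : seq L) (g : gal_of {:L}) :
  <<1 & rs>>%VS = fullv -> (forall x, x \in rs -> g x = x) -> g = 1%g.
Proof.
move=> gen_rs gm; apply/eqP/gal_eqP => x _; rewrite gal_id.
have: (<<1 & rs>> <= fixedField [set g])%VS.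
  apply/Fadjoin_seqP; split; first exact: sub1v.
  move=> y rs_y; apply/fixedFieldP; rewrite ?memvf // => h /set1P->.
  exact: gm.
rewrite gen_rs => /subvP/(_ x (memvf _)) /(fixedFieldP (memvf _)); apply.
by rewrite inE.
Qed.

Lemma multiquadratic_field_exists (s : nat) (d : 'I_s -> int) :
  exists (L : splittingFieldType rat) (m : 'I_s -> L),
  [/\ galois 1 {:L}, forall i, m i ^+ 2 = (d i)%:~R
    & forall g : gal_of {:L}, (forall i, g (m i) = m i) -> g = 1%g].
Proof.
have [Qs [QsC [rs Drs gen_rs]]] :=
  num_field_exists [seq sqrtC ((d i)%:~R : algC) | i <- enum 'I_s].
have sz_rs: size rs = s by rewrite -(size_map QsC) Drs size_map size_enum_ord.
pose m (i : 'I_s) : Qs := rs`_i.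
have Dm i : QsC (m i) = sqrtC (d i)%:~R.
  have := congr1 (fun r => r`_i) Drs; rewrite /= (nth_map 0) ?sz_rs //.
  by rewrite (nth_map i) ?size_enum_ord // nth_ord_enum.
have m2 i : m i ^+ 2 = (d i)%:~R.
  by apply: (fmorph_inj QsC); rewrite rmorphXn /= Dm sqrtCK rmorph_int.
have mem_rs x : x \in rs -> exists i, x = m i.
  by move=> /(nthP 0)[i ltis <-]; rewrite sz_rs in ltis; exists (Ordinal ltis).
(* [Qs] is a splitting field because f splits in it and the roots of f generate it. *)
pose f : {poly Qs} := \prod_i ('X^2 - ((d i)%:~R)%:P).
pose rr := [seq m i | i <- index_enum 'I_s] ++ [seq - m i | i <- index_enum 'I_s].
have Df : f = \prod_(z <- rr) ('X - z%:P).
  rewrite /rr big_cat /= !big_map -big_split /=; apply: eq_bigr => i _.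
  by rewrite polyCN opprK -m2 polyC_exp; ring.
have f_over : f \is a polyOver 1%VS.
  rewrite -[1%VS]/(1%AS : {vspace Qs}); apply: rpred_prod => i _.
  by rewrite rpredB ?rpredX ?polyOverX ?polyOverC //= rpred_int.
have split1 : splittingFieldFor 1 f {:Qs}.
  exists rr; first by rewrite -Df eqpxx.
  apply/eqP; rewrite eqEsubv subvf -gen_rs /=; apply/Fadjoin_seqP; split.
    exact: subv_adjoin_seq.
  move=> x /mem_rs[i ->]; apply: seqv_sub_adjoin; by rewrite mem_cat map_f ?mem_index_enum.
have splitQ : splitting_field_axiom Qs by exists f.
pose LM := FieldExt_isSplittingField.Build _ Qs splitQ.
pose L : splittingFieldType rat := HB.pack (FieldExt.sort Qs) LM.
exists L, m; split=> //.
  apply/and3P; split; first exact: sub1v.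
    by apply/separableP => x _; apply: pcharf0_separable; exact: pchar_number_field.
  by apply/splitting_normalField; [exact: sub1v | exists f].
move=> g gm; apply: (@gal_generators_sep L rs g gen_rs) => x /mem_rs[i ->].
exact: gm.
Qed.

(** * Square roots attached to quadratic characters *)

Section Eigenvector.
Variables (L : splittingFieldType rat) (b : gal_of {:L} -> bool).
Hypothesis galL : galois 1 {:L}.
Hypothesis bM : forall g h, b (g * h)%g = b g (+) b h.

(** Descent on the size of d: while the square of a prime q divides d, y is replaced by y / q. *)
Lemma sqrt_descent (n : nat) (y : L) (d : int) : (`|d| <= n)%N -> y != 0 ->
  (forall g : gal_of {:L}, g y = (-1) ^+ b g * y) -> y ^+ 2 = d%:~R ->
  exists (m : L) (e : int), [/\ forall g : gal_of {:L}, g m = (-1) ^+ b g * m,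
    m ^+ 2 = e%:~R, e != 0 & forall q : nat, prime q -> ~~ ((q%:Z ^+ 2)%R %| e)%Z].
Proof.
elim: n y d => [|n IHn] y d led nzy gy y2; have nzd: d != 0.
- by rewrite -(intrL_eq0 L) -y2 sqrf_eq0.
- by move: led; rewrite leqn0 absz_eq0 (negPf nzd).
- by rewrite -(intrL_eq0 L) -y2 sqrf_eq0.
have [[q [pr_q /dvdzP[e De]]] | noq] :=
  pselect (exists q : nat, prime q /\ ((q%:Z ^+ 2)%R %| d)%Z); last first.
  by exists y, d; split=> // q pr_q; apply/negP => q2d; apply: noq; exists q.
have nzq: (q%:R : L) != 0 by rewrite (intrL_eq0 L q%:Z) eqz_nat -lt0n prime_gt0.
apply: (IHn (y / q%:R) e).
- rewrite -ltnS; apply: leq_trans led; rewrite De abszM abszX /= ltn_Pmulr //.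
    by rewrite -mulnn (leq_trans (prime_gt1 pr_q)) // leq_pmull // prime_gt0.
  by rewrite absz_gt0; apply: contraNneq nzd => e0; rewrite De e0 mul0r.
- by rewrite mulf_neq0 // invr_eq0.
- by move=> g; rewrite rmorphM fmorphV rmorph_nat /= gy mulrA.
rewrite expr_div_n y2 De rmorphM rmorphXn /= mulfK //.
by rewrite expf_neq0.
Qed.

(** The trace twisted by b yields eigenvectors. By independence of automorphisms one of them is
    nonzero, and its square is fixed by the whole group, hence rational. *)
Lemma eigen_sqrt_exists : exists (m : L) (e : int),
  [/\ forall g : gal_of {:L}, g m = (-1) ^+ b g * m,
    m ^+ 2 = e%:~R, e != 0 & forall q : nat, prime q -> ~~ ((q%:Z ^+ 2)%R %| e)%Z].
Proof.
pose T (a : L) : L := \sum_(g : gal_of {:L}) (-1) ^+ b g * g a.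
have gT (h : gal_of {:L}) a : h (T a) = (-1) ^+ b h * T a.
  rewrite /T rmorph_sum mulr_sumr [RHS](reindex_inj (mulIg h)) /=.
  apply: eq_bigr => g _; rewrite rmorphM rmorph_sign /= galM ?memvf // bM signr_addb.
  by rewrite mulrA mulrCA -signr_addb addbb mulr1.
have [a nzTa]: exists a, T a != 0.
  apply: contrapT => noa.
  have T0 a : a \in {:L}%VS -> T a = 0.
    by move=> _; apply/eqP; apply: contrapT => /negP nza; apply: noa; exists a.
  have /eqP := @gal_independent _ L {:L}%AS predT (fun g => (-1) ^+ b g) T0 1%g isT.
  by rewrite signr_eq0.
have /vlineP[r Dr]: T a ^+ 2 \in 1%VS.
  by apply: (fixed_gal_rat galL) => g; rewrite rmorphXn /= gT exprMn sqrr_sign mul1r.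
(* If the square is num / den, scaling by den changes it to the integer num * den. *)
pose k : L := (denq r)%:~R; have nzk: k != 0 by rewrite intrL_eq0 denq_eq0.
apply: (@sqrt_descent _ (k * T a) (numq r * denq r) (leqnn _)).
- exact: mulf_neq0.
- by move=> g; rewrite rmorphM /= rmorph_int gT mulrCA.
have ->: (k * T a) ^+ 2 = k ^+ 2 * ((numq r)%:~R / k).
  rewrite exprMn Dr -{1}(divq_num_den r) -[_%:A]/(in_alg L _).
  by rewrite (rmorphM (in_alg L)) fmorphV !rmorph_int.
rewrite rmorphM /= -/k; field.
exact: nzk.
Qed.

End Eigenvector.

(** * The field of a realized configuration *)

Section RealizedConfiguration.
Variables (s : nat) (gT : finGroupType) (G : {group gT}) (T Z : 'I_s -> {group gT}).
Hypothesis cfg : tame_config G T Z.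
Variables (L : splittingFieldType rat) (phi : {morphism 'Gal({:L} / 1%VS)%g >-> gT}).
Hypotheses (galL : galois 1 {:L}) (tameL : tamely_ramified L).
Hypothesis iso_phi : isom 'Gal({:L} / 1%VS)%g G phi.
Variables (p : 'I_s -> nat) (P : 'I_s -> L -> Prop).
Hypothesis pr_p : forall i, prime (p i).
Hypothesis ram : forall q, prime q -> (ramified L q <-> exists i, q = p i).
Hypothesis overP : forall i, lies_over (P i) (p i).
Hypothesis inertiaP : forall i (g : gal_of {:L}), phi g \in T i <-> inertia_mem (P i) g.

Let Gphi (g : gal_of {:L}) : phi g \in G.
Proof.
have /isomP[_ <-] := iso_phi; apply: mem_morphim; exact: mem_Gal1.
Qed.

Let sp (g : gal_of {:L}) : {set 'I_s} := supp T (phi g).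

Let spM g h j : (j \in sp (g * h)%g) = (j \in sp g) (+) (j \in sp h).
Proof. by rewrite /sp morphM ?mem_Gal1 // (suppM cfg) // in_set. Qed.

Let sp1 : sp 1%g = set0.
Proof. by rewrite /sp morph1 (supp1 cfg). Qed.

Let sp_inj : injective sp.
Proof.
move=> g h /(supp_inj cfg (Gphi g) (Gphi h)).
by have /isomP[/injmP inj_phi _] := iso_phi; apply: inj_phi; exact: mem_Gal1.
Qed.

Let sp_onto A : exists g, sp g = A.
Proof.
have [h Gh <-] := supp_onto cfg A.
have /isomP[_ im] := iso_phi; move: Gh; rewrite -im => /morphimP[g _ _ ->].
by exists g.
Qed.

Let inertia_sp i g : inertia_mem (P i) g <-> sp g \subset [set i].
Proof. by rewrite -inertiaP (mem_inertia cfg). Qed.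

(** The inertia group at [p i] consists of 1 and the element of support {i}; its order 2 is prime to
    [p i] by tameness. *)
Lemma realized_prime_odd i : odd (p i).
Proof.
have [p2 | //] := even_prime (pr_p i).
have [I [DI]] := tameL (pr_p i) (overP i).
have [t Dt] := sp_onto [set i].
have ->: I = [set 1%g; t].
  apply/setP=> g; have inIE: (g \in I) = (sp g \subset [set i]).
    apply/idP/idP => [/DI[_ /inertia_sp //] | Mg].
    by apply/DI; split; [exact: mem_Gal1 | exact/inertia_sp].
  by rewrite inIE !inE subset1 -Dt -sp1 !(inj_eq sp_inj) orbC.
rewrite cards2 -(inj_eq sp_inj) Dt sp1 p2 eq_sym.
by rewrite -card_gt0 cards1.
Qed.

Lemma realized_sqrt j : exists m : L,
  m ^+ 2 = (qstar (p j))%:~R /\ forall g : gal_of {:L}, (g m == m) = (j \notin sp g).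
Proof.
have sqr k := @eigen_sqrt_exists L (fun g => k \in sp g) galL (fun g h => spM g h k).
have [m /fin_all_exists[d /all_and4[gm m2 nzd sqf]]] := fin_all_exists sqr.
have im k : integral (m k).
  exists ('X^2 - (d k)%:P); split; first exact: monicXnsubC.
  by rewrite rmorphB /= map_polyXn map_polyC /= /root !hornerE m2 subrr.
have nzm k : m k != 0 by rewrite -sqrf_eq0 m2 intrL_eq0.
(* The inertia generator at [p k] negates x, so 2 x lies in [P k], and x does because [p k] is
   odd. *)
have flipP k x : integral x -> (forall g : gal_of {:L}, sp g = [set k] -> g x = - x) -> P k x.
  move=> ix gx; have [g Dg] := sp_onto [set k].
  have [_ /(_ x ix)]: inertia_mem (P k) g by apply/inertia_sp; rewrite Dg.
  rewrite (gx g Dg) -opprD -mulr2n => /(idealN (overP k)); rewrite opprK.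
  by apply: (ideal_two (pr_p k) (overP k)) => //; exact: realized_prime_odd.
have pd k : ((p k)%:Z %| d k)%Z.
  apply/(ideal_intr (pr_p k) (overP k)); rewrite -m2 expr2.
  apply: (ideal_mull (overP k)) => //; apply: flipP => // g Dg.
  by rewrite gm Dg set11 mulN1r.
have dvd_ram q : prime q -> (q%:Z %| d j)%Z -> exists k, q = p k.
  move=> pr_q qd; apply/ram => //; apply: (ramified_sqrt (m2 j)) => //; first exact: sqf.
  by rewrite -lt0n prime_gt0.
have dvd_d q : prime q -> (q%:Z %| d j)%Z -> q = p j.
  move=> pr_q qd; have [k Dq] := dvd_ram q pr_q qd.
  have [kj | kj] := eqVneq k j; first by rewrite Dq kj.
  rewrite Dq in qd.
  have /dvdzP[a Da] := qd; have /dvdzP[c Dc] := pd k.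
  have nzp: ((p k)%:R : L) != 0 by rewrite (intrL_eq0 L (p k)%:Z) eqz_nat -lt0n prime_gt0.
  (* Inertia at [p k] negates [n], although [n ^+ 2] is prime to [p k]. *)
  pose n := m j * m k / (p k)%:R.
  have n2: n ^+ 2 = (a * c)%:~R.
    rewrite /n expr_div_n exprMn !m2 Da Dc !rmorphM /=.
    by rewrite -[(p k)%:Z%:~R]/((p k)%:R); field.
  have i_n: integral n.
    exists ('X^2 - (a * c)%:P); split; first exact: monicXnsubC.
    by rewrite rmorphB /= map_polyXn map_polyC /= /root !hornerE n2 subrr.
  have: P k n.
    apply: flipP => // g Dg; rewrite /n !rmorphM fmorphV rmorph_nat /= !gm Dg set11.
    by rewrite in_set1 eq_sym (negPf kj); ring.
  move/(ideal_mull (overP k) i_n); rewrite -expr2 n2 => /(ideal_intr (pr_p k) (overP k)).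
  rewrite dvdzE abszM /= Euclid_dvdM // => /orP[] pk.
    have := sqf j _ (pr_p k); rewrite Da expr2 dvdz_mul2r.
      by rewrite dvdzE pk.
    by rewrite eqz_nat -lt0n prime_gt0.
  have := sqf k _ (pr_p k); rewrite Dc expr2 dvdz_mul2r.
    by rewrite dvdzE pk.
  by rewrite eqz_nat -lt0n prime_gt0.
(* By [dvd_d] a prime factor of the cofactor of [p j] in [d j] is again [p j], whose square would
   divide [d j]. *)
have abs_d: `|d j|%N = p j.
  have /dvdzP[e De] := pd j.
  have [e1 | ne1] := eqVneq `|e|%N 1%N; first by rewrite De abszM e1 mul1n.
  have e_gt1: (1 < `|e|)%N.
    rewrite ltn_neqAle eq_sym ne1 absz_gt0.
    by apply: contraNneq (nzd j) => e0; rewrite De e0 mul0r.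
  have Dq: pdiv `|e| = p j.
    apply: dvd_d; first exact: pdiv_prime.
    by rewrite De dvdz_mulr // dvdzE /= pdiv_dvd.
  have := sqf j _ (pr_p j); rewrite De expr2 dvdz_mul2r.
    by rewrite dvdzE /= -Dq pdiv_dvd.
  by rewrite eqz_nat -lt0n prime_gt0.
have d_cases: d j = qstar (p j) \/ d j = - qstar (p j).
  by have := absz_qstar (p j); lia.
exists (m j); split; last first.
  move=> g; rewrite gm; case: (j \in sp g); rewrite ?mul1r ?eqxx //.
  rewrite mulN1r eq_sym -addr_eq0 -mulr2n -mulr_natl mulf_eq0 (negPf (nzm j)) orbF.
  by rewrite (intrL_eq0 L 2%:Z).
rewrite m2; case: d_cases => [-> // | Dj].
have [k Dk] := qstar_mod4 (realized_prime_odd j).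
have Dd: d j = 4 * k - 1 by lia.
(* The wrong sign makes [d j] equal to 3 mod 4 and 2 ramify, although all ramified primes are odd:
   (1 + m j)^2 = 2 (2 k + m j), while y = (1 + m j) / 2 is not integral because 2 y (1 - y) = 1 - 2
   k is odd. *)
have /ram: ramified L 2; last first.
  by case=> // i p2; have := realized_prime_odd i; rewrite -p2.
have two_neq0: (2 : L) != 0 by rewrite (intrL_eq0 L 2%:Z).
exists (1 + m j), 2; split.
- by apply: integralD => //; exact: (integral_intr _ 1).
- case=> y [iy Dy]; pose z := y * (1 - y).
  have iz: integral z.
    by apply: integralM => //; apply: integralB => //; exact: (integral_intr _ 1).
  have Dz: 2 * z = (1 - 2 * k)%:~R.
    have Dm: m j = 2 * y - 1 by rewrite -Dy; ring.
    have := m2 j; rewrite Dd Dm !rmorphB !rmorphM /= => Dk2.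
    apply: (mulfI two_neq0); apply/eqP; rewrite -subr_eq0; apply/eqP.
    transitivity (4%:~R * k%:~R - 1 - (2 * y - 1) ^+ 2); last by rewrite Dk2 subrr.
    by rewrite /z; ring.
  have [c Dc]: exists c : int, z = c%:~R.
    apply: integral_rat => //; have ->: z = (1 - 2 * k)%:~R / 2 by rewrite -Dz mulrC mulKf.
    by rewrite -[1%VS]/(1%AS : {vspace L}) rpred_div ?rpred_int ?rpred_nat.
  have: 2 * c = 1 - 2 * k by apply: (@intrL_inj L); rewrite /= rmorphM /= -Dc Dz.
  by lia.
exists ((2 * k)%:~R + m j); split.
  by apply: integralD => //; exact: integral_intr.
rewrite sqrrD m2 Dd rmorphB !rmorphM /= expr1n; ring.
Qed.

End RealizedConfiguration.

(** * Realizability and QR matrices *)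

Lemma nonresidues_QR (s : nat) (gT : finGroupType) (G : {group gT}) (T Z : 'I_s -> {group gT})
    (p : 'I_s -> nat) : tame_config G T Z ->
  (forall i j, i != j -> sign_matrix T Z i j = legendre (p i) (p j)) ->
  forall i, nonresidues p i = supp T (zgen T Z i).
Proof.
move=> cfg QR i; apply/setP=> j; rewrite [LHS]in_set.
have [-> | ij] := eqVneq j i; first by rewrite (negPf (supp_zgen_notin cfg i)).
rewrite -QR; last by rewrite eq_sym.
rewrite sign_matrixE [i == j]eq_sym (negPf ij).
by case: (j \in _).
Qed.

Lemma realizable_of_QR (s : nat) (gT : finGroupType) (G : {group gT})
    (T Z : 'I_s -> {group gT}) :
  tame_config G T Z -> QR_matrix (sign_matrix T Z) -> realizable G T Z.
Proof.
move=> cfg [p [p_inj pr_odd QR]].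
have pr_p i : prime (p i) by have /andP[] := pr_odd i.
have odd_p i : odd (p i) by have /andP[] := pr_odd i.
have [L [m [galL m2 m_sep]]] := multiquadratic_field_exists (fun i => qstar (p i)).
have mvM := movedM pr_p m2.
have mv_inj := moved_inj pr_p m2 m_sep.
have mv_onto := moved_onto galL p_inj pr_p m2 m_sep.
(* This is [moved] followed by the inverse of [supp]; [supp_onto] excludes the default value. *)
pose f (g : gal_of {:L}) : gT := odflt 1%g [pick h in G | supp T h == moved m g].
have fP g : f g \in G /\ supp T (f g) = moved m g.
  rewrite /f; case: pickP => [h /andP[Gh /eqP Dh] // | noh].
  have [h Gh Dh] := supp_onto cfg (moved m g).
  by have := noh h; rewrite Gh Dh eqxx.
have fG g := (fP g).1; have fE g := (fP g).2.
have fM : {in 'Gal({:L} / 1%VS)%g &, {morph f : g h / (g * h)%g}}.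
  move=> g h _ _; apply: (supp_inj cfg); rewrite ?groupM //.
  by rewrite (suppM cfg) // !fE mvM.
exists L; split=> //; first exact: (tame_multiquadratic galL p_inj pr_p odd_p m2 m_sep).
exists (Morphism fM); split.
  apply/isomP; split.
    apply/injmP=> g h _ _ /= /(congr1 (supp T)); rewrite !fE.
    exact: mv_inj.
  apply/setP=> h; apply/morphimP/idP => [[g _ _ ->] | Gh]; first exact: fG.
  have [g Dg] := mv_onto (supp T h); exists g; rewrite ?mem_Gal1 //=.
  by apply: (supp_inj cfg); rewrite ?fE.
exists p; split=> //.
  move=> q pr_q; split=> [ram | [i ->]]; last first.
    exact: (ramified_at pr_p m2).
  have [i /eqP Di | noi] := pickP (fun i => q == p i); first by exists i.
  by case: (unramified_away galL pr_p odd_p m2 m_sep pr_q) => // i; rewrite noi.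
move=> i; have [P Pi] := prime_over_exists L (pr_p i).
exists P; split=> // g _ /=; split.
  rewrite (mem_inertia cfg) // fE; split.
    by move=> Mg; apply/(inertia_memE galL p_inj pr_p odd_p m2 m_sep Pi).
  by move/(inertia_memE galL p_inj pr_p odd_p m2 m_sep Pi).
rewrite (mem_decomp cfg) // fE -(nonresidues_QR cfg QR).
split.
  move=> Mg; apply/(decomp_memE galL p_inj pr_p odd_p m2 m_sep Pi).
  by case/orP: Mg => /eqP; [left | right].
by case/(decomp_memE galL p_inj pr_p odd_p m2 m_sep Pi) => ->; rewrite eqxx ?orbT.
Qed.

Lemma QR_of_realizable (s : nat) (gT : finGroupType) (G : {group gT})
    (T Z : 'I_s -> {group gT}) :
  tame_config G T Z -> realizable G T Z -> QR_matrix (sign_matrix T Z).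
Proof.
move=> cfg [L [galL tameL [phi [iso_phi [p [p_inj pr_p ram /fin_all_exists[P DP]]]]]]].
have overP i : lies_over (P i) (p i) by case: (DP i).
have inertiaP i (g : gal_of {:L}) : phi g \in T i <-> inertia_mem (P i) g.
  by case: (DP i) => _ /(_ g (mem_Gal1 g))[].
have odd_p := realized_prime_odd cfg tameL iso_phi pr_p overP inertiaP.
have [m /all_and2[m2 Dm]] :=
  fin_all_exists (realized_sqrt cfg galL tameL iso_phi pr_p ram overP inertiaP).
have movedE g : moved m g = supp T (phi g).
  by apply/setP=> j; rewrite in_set Dm negbK.
have Gphi (g : gal_of {:L}) : phi g \in G.
  by have /isomP[_ <-] := iso_phi; apply: mem_morphim; exact: mem_Gal1.
have m_sep (g : gal_of {:L}) : (forall i, g (m i) = m i) -> g = 1%g.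
  move=> gm; have /isomP[/injmP inj_phi _] := iso_phi.
  apply: inj_phi; rewrite ?mem_Gal1 ?group1 // morph1.
  apply: (supp_inj cfg); rewrite ?group1 // (supp1 cfg) -movedE.
  by apply/setP=> j; rewrite !inE gm eqxx.
exists p; split=> //; first by move=> i; rewrite pr_p odd_p.
have RE i : nonresidues p i = supp T (zgen T Z i).
  (* Two descriptions of the same decomposition group: away from i, its sets are empty or the
     support of z_i, and empty or the nonresidues. Testing each of the two sets in the other
     description shows that they are equal. *)
  have decE A : (A :\ i == set0) || (A :\ i == supp T (zgen T Z i)) <->
      A :\ i = set0 \/ A :\ i = nonresidues p i.
    have [h Gh Dh] := supp_onto cfg A.
    have /isomP[_ im] := iso_phi; move: Gh; rewrite -im => /morphimP[g _ _ Dg].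
    have DA: A = moved m g by rewrite movedE -Dg.
    have := mem_decomp cfg i (Gphi g); rewrite -movedE -DA => <-.
    rewrite DA -(decomp_memE galL p_inj pr_p odd_p m2 m_sep (overP i)).
    by case: (DP i) => _ /(_ g (mem_Gal1 g))[].
  have Ri: nonresidues p i :\ i = nonresidues p i.
    by apply/setP=> j; rewrite !inE; case: (j == i).
  have Si: supp T (zgen T Z i) :\ i = supp T (zgen T Z i).
    apply/setP=> j; rewrite in_setD1; have [-> | //] := eqVneq j i.
    by rewrite (negPf (supp_zgen_notin cfg i)).
  have := (decE (nonresidues p i)).2 (or_intror Ri).
  rewrite Ri => /orP[/eqP R0 | /eqP //].
  have := (decE (supp T (zgen T Z i))).1; rewrite Si eqxx orbT => /(_ isT)[] //.
  by rewrite R0.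
move=> i j ij; rewrite sign_matrixE (negPf ij) -RE inE eq_sym ij /=.
have: (p i)%:R != 0 :> 'F_(p j).
  by rewrite -(dvdn_pcharf (pchar_Fp (pr_p j))) dvdn_prime2 // (inj_eq p_inj) eq_sym.
by rewrite legendreE // => /qchar_neq0[] ->.
Qed.

(** * Reciprocity and sign patterns *)

Lemma legendre_sym (p q : nat) : prime p -> odd p -> prime q -> odd q -> p != q ->
  legendre p q = (-1) ^+ ((p.-1)./2 * (q.-1)./2) * legendre q p.
Proof.
move=> pr_p odd_p pr_q odd_q neq_pq.
rewrite -(qchar_qstar pr_p odd_p pr_q odd_q neq_pq) (legendreE q pr_p) /qstar.
rewrite rmorphM /= qcharM // rmorphXn /= rmorphN1; congr (_ * _).
have qcharX (a : 'F_p) n : qchar (a ^+ n) = qchar a ^+ n.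
  by elim: n => [|n IHn]; rewrite ?qchar1 // !exprS qcharM // IHn.
by rewrite qcharX qcharN1 // exprM.
Qed.

Lemma legendre_eqN1 (a p : nat) : ~~ (p %| a)%N ->
  (forall x, (x < p)%N -> (x * x) %% p != a %% p)%N -> legendre a p = -1.
Proof.
move=> /negPf pa nosq; rewrite /legendre pa.
case: existsP => // -[x]; by rewrite (negPf (nosq x (ltn_ord x))).
Qed.

Lemma legendre_eq1 (a p x : nat) : ~~ (p %| a)%N -> (x < p)%N ->
  ((x * x) %% p == a %% p)%N -> legendre a p = 1.
Proof.
move=> /negPf pa ltx sq; rewrite /legendre pa.
by case: existsP => // nosq; case: nosq; exists (Ordinal ltx).
Qed.

(** For s = 2 there are four patterns. Unequal entries need two primes that are 3 mod 4, here 3 and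
    7 in either order; 5 is 1 mod 4, and with 11 it gives two residues, with 3 two nonresidues. *)
Lemma QR_small (s : nat) (M : 'I_s -> 'I_s -> int) : (s <= 2)%N ->
  (forall i j, i != j -> M i j = 1 \/ M i j = -1) -> QR_matrix M.
Proof.
have L5_11: legendre 5 11 = 1 by apply: (@legendre_eq1 _ _ 4).
have L11_5: legendre 11 5 = 1 by apply: (@legendre_eq1 _ _ 1).
have L7_3: legendre 7 3 = 1 by apply: (@legendre_eq1 _ _ 1).
have L3_5: legendre 3 5 = -1 by apply: legendre_eqN1 => //; do 5!case=> //.
have L5_3: legendre 5 3 = -1 by apply: legendre_eqN1 => //; do 3!case=> //.
have L3_7: legendre 3 7 = -1 by apply: legendre_eqN1 => //; do 7!case=> //.
case: s M => [|[|[|//]]] M _ M1.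
- by exists (fun=> 3%N); split; case.
- by exists (fun=> 3%N); split=> // i j; rewrite !ord1.
pose i0 : 'I_2 := ord0; pose i1 : 'I_2 := ord_max.
have QR2 a b : prime a && odd a -> prime b && odd b -> a != b ->
    M i0 i1 = legendre a b -> M i1 i0 = legendre b a -> QR_matrix M.
  move=> pa pb neq_ab M01 M10; exists (fun i : 'I_2 => if i == i0 then a else b).
  have ord2 (i : 'I_2) : i = i0 \/ i = i1.
    by case: i => [[|[|//]]] lti; [left | right]; exact: val_inj.
  split=> [i j | i | i j].
  - case: (ord2 i) (ord2 j) => -> [] -> //= /eqP; first by rewrite (negPf neq_ab).
    by rewrite eq_sym (negPf neq_ab).
  - by case: ifP.
  by case: (ord2 i) (ord2 j) => -> [] -> //= _.
case: (M1 i0 i1 isT) => M01; case: (M1 i1 i0 isT) => M10.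
- by apply: (QR2 5 11); rewrite ?M01 ?M10.
- by apply: (QR2 7 3); rewrite ?M01 ?M10.
- by apply: (QR2 3 7); rewrite ?M01 ?M10.
by apply: (QR2 3 5); rewrite ?M01 ?M10.
Qed.

(* [z_0 = x_1 x_2] and [z_i = 1] for [i <> 0]: as [m_01 <> m_10] and
   [m_02 <> m_20], all of [p_0], [p_1], [p_2] would be [3 mod 4], contradicting
   [m_12 = m_21]. *)
Section Counterexample.
Variable n : nat.
Local Notation gT := 'rV['F_2]_(n.+3).
Let e (i : 'I_n.+3) : gT := delta_mx 0 i.
Let i0 : 'I_n.+3 := inord 0.
Let i1 : 'I_n.+3 := inord 1.
Let i2 : 'I_n.+3 := inord 2.
Let G : {group gT} := [set: gT]%G.
Let T (i : 'I_n.+3) : {group gT} := <[e i]>%G.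
Let y : gT := (e i1 * e i2)%g.
Let Z (i : 'I_n.+3) : {group gT} := if i == i0 then (T i <*> <[y]>)%G else T i.

Lemma counterexample_config : tame_config G T Z.
Proof.
have abelG: (2.-abelem G)%g by exact: mx_Fp_abelem.
split=> //.
- by rewrite cardsT card_mx card_Fp // mul1n.
- apply/eqP; rewrite eqEsubset subsetT; apply/subsetP=> v _; rewrite (row_sum_delta v).
  pose H : {group gT} := <<\bigcup_(i < n.+3) T i>>%G.
  apply: (big_ind (fun w => w \in H)) => [|w1 w2 H1 H2|j _].
  + exact: (group1 H).
  + exact: (groupM H1 H2).
  have ->: v 0 j *: delta_mx 0 j = (e j ^+ (v 0 j))%g.
    by rewrite FinRing.zmodXgE -[v 0 j in LHS](natr_Zp (v 0 j)) scaler_nat.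
  by apply: groupX; apply/mem_gen/bigcupP; exists j => //; exact: cycle_id.
move=> i; split; rewrite ?cycle_cyclic ?subsetT //.
  by rewrite /Z; case: ifP => // _; exact: joing_subl.
have nT (A : {set gT}) : A \subset 'N(T i)%g.
  rewrite cents_norm // (sub_abelian_cent2 (abelem_abelian abelG)) ?subsetT //.
rewrite /Z; case: ifP => _; last by rewrite trivg_quotient cyclic1.
by rewrite quotientYidl ?nT // quotient_cyclic // cycle_cyclic.
Qed.

Lemma counterexample_not_realizable : ~ realizable G T Z.
Proof.
have cfg := counterexample_config.
have inG v : v \in G by rewrite in_setT.
have supp_e i : supp T (e i) = [set i].
  apply/eqP; have: supp T (e i) \subset [set i] by rewrite -(mem_inertia cfg) ?cycle_id.
  rewrite subset1 => /orP[// | /eqP]; rewrite -(supp1 cfg) => /(supp_inj cfg (inG _) (inG _)).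
  move/matrixP/(_ 0 i); rewrite !mxE !eqxx => /eqP.
  by rewrite oner_eq0.
have ordE (k : nat) : (k < 3)%N -> (inord k : 'I_n.+3) = k :> nat.
  by move=> k3; rewrite inordK // (leq_trans k3).
have i01 : i0 != i1 by rewrite -val_eqE /= !ordE.
have i02 : i0 != i2 by rewrite -val_eqE /= !ordE.
have i12 : i1 != i2 by rewrite -val_eqE /= !ordE.
have supp_y j : (j \in supp T y) = (j == i1) || (j == i2).
  rewrite (suppM cfg) // in_set !supp_e !in_set1.
  by have [-> | //] := eqVneq j i1; rewrite (negPf i12).
(* y lies in [Z i0] and its support is nonempty and avoids i0, so it is the support of z_0. *)
have R0 j : (j \in supp T (zgen T Z i0)) = (j == i1) || (j == i2).
  have Zy: y \in Z i0.
    by rewrite /Z eqxx; apply: (subsetP (joing_subr _ _)); exact: cycle_id.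
  have Dy: supp T y :\ i0 = supp T y.
    apply/setP=> k; rewrite in_setD1 supp_y; have [-> | //] := eqVneq k i0.
    by rewrite (negPf i01) (negPf i02).
  move: Zy; rewrite (mem_decomp cfg) // Dy => /orP[/eqP y0 | /eqP <- //].
  by have := supp_y i1; rewrite y0 inE eqxx.
(* As [Z i] is [T i] here, z_i could only have the coordinate i, which it lacks. *)
have Ri i j : i != i0 -> (j \in supp T (zgen T Z i)) = false.
  move=> ni0; have [h _ Dh] := supp_onto cfg (supp T (zgen T Z i)).
  have Ni := supp_zgen_notin cfg i.
  have: h \in Z i.
    rewrite (mem_decomp cfg) // Dh; apply/orP; right; apply/eqP/setP=> k.
    by rewrite in_setD1; have [-> | //] := eqVneq k i; rewrite (negPf Ni).
  rewrite /Z (negPf ni0) (mem_inertia cfg) // Dh => /subsetP sub.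
  apply/negP => Rj; have := sub j Rj; rewrite in_set1 => /eqP ji.
  by move: Ni; rewrite -{1}ji => /negP[].
move=> /(QR_of_realizable cfg)[p [p_inj pr_odd QR]].
have sym i j : i != j -> legendre (p i) (p j) =
    (-1) ^+ (odd (p i).-1./2 && odd (p j).-1./2) * legendre (p j) (p i).
  move=> ij; have /andP[pri oddi] := pr_odd i; have /andP[prj oddj] := pr_odd j.
  by rewrite -oddM signr_odd -legendre_sym // (inj_eq p_inj).
have leg i j : i != j -> legendre (p i) (p j) = (-1) ^+ (j \in supp T (zgen T Z i)).
  by move=> ij; rewrite -QR // sign_matrixE (negPf ij).
have i10 : i1 != i0 by rewrite eq_sym.
have i20 : i2 != i0 by rewrite eq_sym.
have i21 : i2 != i1 by rewrite eq_sym.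
have := sym _ _ i01; rewrite (leg _ _ i01) (leg _ _ i10) R0 eqxx Ri //.
have := sym _ _ i02; rewrite (leg _ _ i02) (leg _ _ i20) R0 eqxx orbT Ri //.
have := sym _ _ i12; rewrite (leg _ _ i12) (leg _ _ i21) !Ri //.
by do 3!case: odd.
Qed.

End Counterexample.

Theorem theorem3p7 :
  (forall (s : nat) (gT : finGroupType) (G : {group gT}) (T Z : 'I_s -> {group gT}),
     (1 <= s)%N -> tame_config G T Z ->
     (realizable G T Z <-> QR_matrix (sign_matrix T Z)))
  /\ (forall (s : nat) (gT : finGroupType) (G : {group gT}) (T Z : 'I_s -> {group gT}),
     (1 <= s <= 2)%N -> tame_config G T Z -> realizable G T Z)
  /\ (forall s : nat, (3 <= s)%N ->
     exists (gT : finGroupType) (G : {group gT}) (T Z : 'I_s -> {group gT}),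
       tame_config G T Z /\ ~ realizable G T Z).
Proof.
split; [|split].
- move=> s gT G T Z _ cfg; split; first exact: QR_of_realizable.
  exact: realizable_of_QR.
- move=> s gT G T Z /andP[_ s2] cfg; apply: (realizable_of_QR cfg).
  apply: QR_small => // i j ij.
  by rewrite sign_matrixE (negPf ij); case: (_ \in _); [right | left].
case=> [|[|[|n]]] // _; do 4!eexists.
split; [exact: counterexample_config | exact: counterexample_not_realizable].
Qed.
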